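(* Let $K$ and $L$ be two star bodies in $\mathbb{R}^5$, each having countably many diameters. Assume that there exists a direction $\zeta\in S^4$ such that $K$ has a diameter $d_K(\zeta)$ parallel to $\zeta$ and containing the origin, and such that, for every four dimensional linear subspace $H$ of $\mathbb{R}^5$ containing $\zeta$, the sections $K\cap H$ and $L\cap H$ are directly congruent. Assume also that, for every such $H$, the sections $K\cap H$ and $L\cap H$ have no $SO(4)$ symmetries, and the three dimensional sections $K\cap(H\cap\zeta^\perp)$ and $L\cap(H\cap\zeta^\perp)$ have no $O(3)$ symmetries. Then $K=L+b$ or $K=-L+b$ for some $b\in\mathbb{R}^5$ parallel to $\zeta$.
   Context: A body is a compact set which is equal to the closure of its non-empty interior. A set $S\subset\mathbb{R}^n$ is star-shaped with respect to an interior point $p$ if the segment from $p$ to any point of $S$ is contained in $S$. For a nonempty compact set $K$ that is star-shaped with respect to the origin, the radial function is $\rho_K(x)=\max\{c: cx\in K\}$, $x\in\mathbb{R}^n\setminus\{0\}$. A star body is a body that is star-shaped with respect to the origin and whose radial function is continuous. A segment $[z,y]\subset K$ is a diameter of the star body $K$ if $|z-y|=\max_{[a,b]\subset K}|a-b|$; ''countably many diameters'' means that the set of diameters is countable (possibly finite). If $K$ has a diameter parallel to $\zeta$ containing the origin, it is denoted $d_K(\zeta)$. $\zeta^\perp$ is the hyperplane through the origin orthogonal to $\zeta$. Here $O(k,H)$ and $SO(k,H)$ denote the orthogonal and special orthogonal groups of a $k$ dimensional subspace $H$. Two subsets $D,B$ of a $k$ dimensional subspace $H$ are directly congruent if $\varphi(D)=B+a$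 for some $a\in H$ and some $\varphi\in SO(k,H)$. A set $D\subset H$ has an $SO(k)$ symmetry (respectively, an $O(k)$ symmetry) if $\varphi(D)=D+a$ for some $a\in H$ and some non-identity $\varphi\in SO(k,H)$ (respectively, $\varphi\in O(k,H)$). ''Parallel to $\zeta$'' means a real scalar multiple of $\zeta$ (possibly zero). *)

(* Defs.v *)
From HB Require Import structures.
From mathcomp Require Import all_boot all_order all_algebra.
From mathcomp Require Import all_classical all_reals all_analysis.

Set Implicit Arguments.
Unset Strict Implicit.
Unset Printing Implicit Defensive.

Import Order.TTheory GRing.Theory Num.Theory.
Import numFieldNormedType.Exports.

Local Open Scope classical_set_scope.
Local Open Scope ring_scope.

Section Euclidean.
Variables (R : realType) (n : nat).
Local Notation V := 'rV[R]_n.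
Implicit Types (x y z b : V) (S K D B : set V) (H : {vspace V}).

Definition dot x y : R := (x *m y^T) 0 0.

(* The library norm on 'rV[R]_n is the sup norm; it induces the same topology,
   but lengths have to be measured with the Euclidean norm. *)
Definition enorm x : R := Num.sqrt (dot x x).

Definition hyperplane_orth z : {vspace V} := lker (linfun (mulmxr z^T)).

Lemma mem_hyperplane_orth z x : (x \in hyperplane_orth z) = (dot x z == 0).
Proof.
rewrite memv_ker lfunE /= /dot; apply/eqP/eqP => [->|h]; first by rewrite mxE.
by apply/matrixP => i j; rewrite !ord1 h mxE.
Qed.

Definition translate S b : set V := [set x + b | x in S].

Definition reflect0 S : set V := [set - x | x in S].

Definition segment x y : set V :=
  [set (1 - t) *: x + t *: y | t in [set t : R | 0 <= t <= 1]].

Definition body K : Prop :=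
  [/\ compact K, interior K !=set0 & K = closure (interior K)].

Definition star_shaped S z : Prop :=
  interior S z /\ forall x, S x -> segment z x `<=` S.

(* The supremum is a maximum when K is compact, contains 0 and x != 0. *)
Definition radial K x : R := sup [set c : R | K (c *: x)].

Definition star_body K : Prop :=
  [/\ body K, star_shaped K 0 & {within ~` [set 0], continuous (radial K)}].

Definition diameter_ends K z y : Prop :=
  segment z y `<=` K /\
  forall a b, segment a b `<=` K -> enorm (a - b) <= enorm (z - y).

(* A diameter is a segment, i.e. a set of points: [z, y] and [y, z] are the
   same diameter. *)
Definition diameters K : set (set V) :=
  [set D | exists z y, D = segment z y /\ diameter_ends K z y].

Definition parallel b z : Prop := exists t : R, b = t *: z.

Definition has_central_diameter K z : Prop :=
  exists x y, [/\ diameter_ends K x y, parallel (y - x) z & segment x y 0].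

Definition section K H : set V := K `&` [set` H].

Definition orthogonal_group H : set 'End(subvs_of H) :=
  [set f | forall u v, dot (vsval (f u)) (vsval (f v)) = dot (vsval u) (vsval v)].

Definition lfun_det (W : vectType R) (f : 'End(W)) : R :=
  \det (passmx.mxof (vbasis fullv) (vbasis fullv) f).

Definition special_orthogonal_group H : set 'End(subvs_of H) :=
  [set f | orthogonal_group f /\ lfun_det f = 1].

(* The image f(D) of a set D contained in H. *)
Definition endo_image H (f : 'End(subvs_of H)) D : set V :=
  [set vsval (f u) | u in [set u : subvs_of H | D (vsval u)]].

Definition directly_congruent H D B : Prop :=
  exists f : 'End(subvs_of H), exists a,
    [/\ special_orthogonal_group f, a \in H & endo_image f D = translate B a].

Definition has_SO_symmetry H D : Prop :=
  exists f : 'End(subvs_of H), exists a,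
    [/\ special_orthogonal_group f, f <> \1%VF, a \in H
      & endo_image f D = translate D a].

Definition has_O_symmetry H D : Prop :=
  exists f : 'End(subvs_of H), exists a,
    [/\ orthogonal_group f, f <> \1%VF, a \in H
      & endo_image f D = translate D a].

End Euclidean.

(* Main.v *)
Require Import Defs.
From mathcomp Require Import all_boot all_order all_algebra.
From mathcomp Require Import all_classical all_reals all_analysis.
From mathcomp Require Import zify ring lra.
Import Order.TTheory GRing.Theory Num.Theory.
Import numFieldNormedType.Exports.
Local Open Scope classical_set_scope.
Local Open Scope ring_scope.
Set Implicit Arguments.
Unset Strict Implicit.
Unset Printing Implicit Defensive.

(** Write [zeta^perp] for the hyperplane orthogonal to [zeta].  The hyperplanes
    containing [zeta] are the [w^perp] with [w] nonzero in [zeta^perp].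

    Along the line of [zeta] the congruences are rigid.  A segment of [L] lies in
    some [w^perp], so it is no longer than the diameters of [K]; hence the
    congruence on [w^perp] carries the central diameter of [K] to a diameter of
    [L].  Only countably many diameters of [L] are off the line of [zeta], and
    [w] can be approximated by vectors orthogonal to none of them
    ([approx_avoiding_hyperplanes]).  For such [w] the congruence therefore maps
    [zeta] to [zeta] or [- zeta], up to a translation along [zeta] which is
    determined by the sign ([generic_matched]).  By compactness of the orthogonal
    group such a congruence [M_w] exists for every [w] ([exists_matched]).  It is
    unique, because two of them would compose to a symmetry of the section
    ([matched_unique]); a closed graph in a compact space is the graph of a
    continuous function, so [M_w] depends continuously on [w], and its sign [s] is
    the same for all [w].

    The heart of the proof is [exists_fixing_turn]: for every [x] orthogonal to
    [zeta] there is [w] orthogonal to [x] and [zeta] with [x M_w = s x].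
    Restricted to the orthogonal complement of [w] and [zeta], [s M_w] is a
    rotation of a three dimensional space.  If no such [w] existed, the axes of
    these rotations would never be parallel to [x], and their projections
    orthogonal to [x] would be a continuous field of tangent lines on the sphere
    of the unit vectors [w] orthogonal to [x] and [zeta].  No such field exists:
    in polar coordinates, the double of its angle has winding number [-2] on small
    circles around the pole but [0] on the equator, where antipodal points [w] and
    [- w] carry the same congruence ([no_polar_field]).

    Consequently [M_w] acts as the scalar [s] on the plane spanned by [x] and
    [zeta], which is contained in [w^perp].  These planes cover the whole space, so
    a single map [y |-> s y - k zeta] carries [K] to [L].  *)

(** * Inner products and orthogonal matrices *)

Section LinearAlgebra.
Variable R : realType.

Section Dot.
Variable n : nat.
Implicit Types (x y z : 'rV[R]_n) (M : 'M[R]_n).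

Lemma dotE x y : dot x y = \sum_i x 0 i * y 0 i.
Proof. by rewrite /dot mxE; apply: eq_bigr => i _; rewrite mxE. Qed.

Lemma dotC x y : dot x y = dot y x.
Proof. by rewrite !dotE; apply: eq_bigr => i _; rewrite mulrC. Qed.

Lemma dotDl x y z : dot (x + y) z = dot x z + dot y z.
Proof. by rewrite /dot mulmxDl mxE. Qed.

Lemma dotDr x y z : dot z (x + y) = dot z x + dot z y.
Proof. by rewrite dotC dotDl !(dotC z). Qed.

Lemma dotZl k x y : dot (k *: x) y = k * dot x y.
Proof. by rewrite /dot -scalemxAl mxE. Qed.

Lemma dotZr k x y : dot x (k *: y) = k * dot x y.
Proof. by rewrite dotC dotZl dotC. Qed.

Lemma dotNl x y : dot (- x) y = - dot x y.
Proof. by rewrite -scaleN1r dotZl mulN1r. Qed.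

Lemma dotNr x y : dot x (- y) = - dot x y.
Proof. by rewrite dotC dotNl dotC. Qed.

Lemma dotBl x y z : dot (x - y) z = dot x z - dot y z.
Proof. by rewrite dotDl dotNl. Qed.

Lemma dotBr x y z : dot z (x - y) = dot z x - dot z y.
Proof. by rewrite dotDr dotNr. Qed.

Lemma dot0l x : dot 0 x = 0.
Proof. by rewrite /dot mul0mx mxE. Qed.

Definition dotP := (dotDl, dotDr, dotZl, dotZr, dotNl, dotNr, dotBl, dotBr).

Lemma dot_ge0 x : 0 <= dot x x.
Proof. by rewrite dotE sumr_ge0 // => i _; rewrite -expr2 sqr_ge0. Qed.

Lemma dot_eq0 x : (dot x x == 0) = (x == 0).
Proof.
apply/eqP/eqP => [|->]; last exact: dot0l.
rewrite dotE => /eqP; rewrite psumr_eq0 => [/allP h|i _].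
  apply/rowP => i; have := h i (mem_index_enum i).
  by rewrite -expr2 sqrf_eq0 => /eqP ->; rewrite mxE.
by rewrite -expr2 sqr_ge0.
Qed.

Lemma dot_gt0 x : x != 0 -> 0 < dot x x.
Proof. by move=> x0; rewrite lt_neqAle dot_ge0 andbT eq_sym dot_eq0. Qed.

Lemma enorm_dot x : enorm x ^+ 2 = dot x x.
Proof. by rewrite sqr_sqrtr // dot_ge0. Qed.

Lemma enorm1_dot x : enorm x = 1 -> dot x x = 1.
Proof. by rewrite -enorm_dot => ->; rewrite expr1n. Qed.

Lemma dot_mulmx M x y : M *m M^T = 1%:M -> dot (x *m M) (y *m M) = dot x y.
Proof. by move=> oM; rewrite /dot trmx_mul mulmxA -(mulmxA x) oM mulmx1. Qed.

Lemma dot_mulmx_tr M x y : dot (x *m M) y = dot x (y *m M^T).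
Proof. by rewrite /dot trmx_mul trmxK mulmxA. Qed.

End Dot.

Lemma det_mx2 (A : 'M[R]_2) : \det A = A 0 0 * A 1 1 - A 0 1 * A 1 0.
Proof.
rewrite (expand_det_row _ 0) !big_ord_recl big_ord0 /cofactor !det_mx11 !mxE /=.
rewrite addr0 /bump /= expr0 mul1r addn1 expr1 mulN1r mulrN.
by congr (_ * A _ _ - A _ _ * A _ _); apply: val_inj.
Qed.

(** Here [s A] is a rotation.  If its axis is spanned by the unit vector [v] and
    its angle is [t], the symmetric part of its matrix is [cos t + (1 - cos t) v v^T].  The two
    equations say that the lower right block of this symmetric matrix is scalar,
    which forces [v] to be the first basis vector unless the rotation is the
    identity.  The proof avoids the axis: the cofactor identity gives
    [s A00 = A11^2 + A12^2], and the lengths of the rows and columns do the rest. *)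
Lemma so3_fixed_coordinate (A : 'M[R]_3) (s : R) :
  A *m A^T = 1%:M -> \det A = s -> s ^+ 2 = 1 ->
  A 1 1 = A 2 2 -> A 1 2 = - A 2 1 -> A 0 0 = s.
Proof.
move=> oA dA s1 e11 e12.
have o i j : \sum_k A i k * A j k = (i == j)%:R.
  have /matrixP/(_ i j) := oA; rewrite !mxE => <-.
  by apply: eq_bigr => k _; rewrite mxE.
have o' i j : \sum_k A k i * A k j = (i == j)%:R.
  have /matrixP/(_ i j) := mulmx1C oA; rewrite !mxE => <-.
  by apply: eq_bigr => k _; rewrite mxE.
have cof : s * A 0 0 = A 1 1 * A 2 2 - A 1 2 * A 2 1.
  have adjA : \adj A = s *: A^T.
    by rewrite -[\adj A]mulmx1 -oA mulmxA mul_adj_mx dA mul_scalar_mx.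
  have /matrixP/(_ 0 0) := adjA; rewrite !mxE => <-.
  rewrite /cofactor det_mx2 !mxE addn0 expr0 mul1r.
  by congr (A _ _ * A _ _ - A _ _ * A _ _); apply: val_inj.
have sum3 (f : 'I_3 -> R) : \sum_k f k = f 0 + f 1 + f 2.
  rewrite !big_ord_recl big_ord0 addr0 addrA.
  by congr (f _ + f _ + f _); apply: val_inj.
have := o 1 1; have := o 2 2; have := o' 0 0; rewrite !sum3 !eqxx !mulr1n.
move: cof; rewrite e12 -e11; move: (A 0 0) (A 1 1) (A 2 1) (A 1 0) (A 2 0).
move=> a b c d e cof h0 h2 h1; apply/eqP; rewrite -subr_eq0 -sqrf_eq0.
by apply/eqP; move: h0 h1 h2 cof s1; rewrite /= => h0 h1 h2 cof s1; lra.
Qed.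

(** In the orthonormal basis formed by the rows of [Q1] and [Q2], [M] is block
    diagonal with blocks [D] and [A]. *)
Lemma det_compression (p q : nat) (Q1 : 'M[R]_(p, p + q)) (Q2 : 'M[R]_(q, p + q))
    (M : 'M[R]_(p + q)) (D : 'M[R]_p) :
  Q1 *m Q1^T = 1%:M -> Q2 *m Q2^T = 1%:M -> Q1 *m Q2^T = 0 ->
  M *m M^T = 1%:M -> Q1 *m M = D *m Q1 -> Q2 *m M *m Q1^T = 0 ->
  let A := Q2 *m M *m Q2^T in A *m A^T = 1%:M /\ \det D * \det A = \det M.
Proof.
move=> o1 o2 o12 oM QD Q0 A.
have o21 : Q2 *m Q1^T = 0 by rewrite -[RHS]trmx0 -o12 trmx_mul trmxK.
pose Q := col_mx Q1 Q2.
have oQ : Q *m Q^T = 1%:M.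
  by rewrite /Q tr_col_mx mul_col_row o1 o2 o12 o21 -scalar_mx_block.
have oQ' : Q^T *m Q = 1%:M := mulmx1C oQ.
have N : Q *m M *m Q^T = block_mx D 0 0 A.
  rewrite /Q tr_col_mx mul_col_mx mul_col_row QD Q0.
  by rewrite -(mulmxA D Q1) -(mulmxA D Q1) o1 o12 mulmx1 mulmx0.
split; last first.
  have /(congr1 determinant) := N; rewrite det_ublock !det_mulmx det_tr => <-.
  have : \det Q * \det Q = 1 by rewrite -[X in _ * X]det_tr -det_mulmx oQ det1.
  by move=> d; rewrite mulrAC d mul1r.
have : (Q *m M *m Q^T) *m (Q *m M *m Q^T)^T = 1%:M.
  rewrite !trmx_mul trmxK !mulmxA -(mulmxA (Q *m M)) oQ' mulmx1.
  by rewrite -(mulmxA Q) oM mulmx1 oQ.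
rewrite N tr_block_mx mulmx_block !trmx0 !(mul0mx, mulmx0, addr0, add0r).
by rewrite scalar_mx_block => /eq_block_mx[].
Qed.

Lemma orthogonal_direction (n k : nat) (A : 'M[R]_(k, n)) : (k < n)%N ->
  exists2 v : 'rV[R]_n, dot v v = 1 & A *m v^T = 0.
Proof.
move=> kn; have : kermx A^T != 0.
  rewrite -mxrank_eq0 mxrank_ker mxrank_tr -lt0n subn_gt0.
  exact: leq_ltn_trans (rank_leq_row A) kn.
case/rowV0Pn => v /sub_kermxP vA v0; have d0 := dot_gt0 v0.
exists ((Num.sqrt (dot v v))^-1 *: v).
  rewrite dotZl dotZr mulrA -expr2 exprVn sqr_sqrtr ?dot_ge0 // mulVf //.
  by rewrite gt_eqF.
by rewrite linearZ /= -scalemxAr -[A]trmxK -trmx_mul vA trmx0 scaler0.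
Qed.

Lemma orthogonal_direction_seq (n : nat) (s : seq 'rV[R]_n) : (size s < n)%N ->
  exists2 v : 'rV[R]_n, dot v v = 1 & {in s, forall u, dot u v = 0}.
Proof.
move=> /(@orthogonal_direction n _ (\matrix_(i < size s) s`_i)) [v v1 sv].
exists v => // u us; have us' : (index u s < size s)%N by rewrite index_mem.
have /matrixP/(_ (Ordinal us') 0) := sv; rewrite [LHS]mxE [RHS]mxE => <-.
by rewrite dotE; apply: eq_bigr => k _; rewrite !mxE /= nth_index.
Qed.

End LinearAlgebra.

(** * Winding numbers *)

Section Winding.
Variable R : realType.

Lemma rotation_by_atan (a b c d : R) : 0 < a * c + b * d ->
  let t := atan ((a * d - b * c) / (a * c + b * d)) in
  exists2 rho : R, 0 < rho &
    c = rho * (a * cos t - b * sin t) /\ d = rho * (a * sin t + b * cos t).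
Proof.
move=> D0 t; have Dn0 : a * c + b * d != 0 by rewrite gt_eqF.
have ct : 0 < cos t by apply: cos_gt0_pihalf; rewrite atan_gtNpi2 atan_ltpi2.
have st : sin t = (a * d - b * c) / (a * c + b * d) * cos t.
  have := atanK ((a * d - b * c) / (a * c + b * d)); rewrite -/t /tan => <-.
  by rewrite mulfVK // gt_eqF.
have ab : 0 < a ^+ 2 + b ^+ 2.
  rewrite lt_neqAle addr_ge0 ?sqr_ge0 // andbT eq_sym paddr_eq0 ?sqr_ge0 //.
  rewrite !sqrf_eq0; apply: contraTN D0 => /andP[/eqP -> /eqP ->].
  by rewrite !mul0r addr0 ltxx.
have ct0 : cos t != 0 by rewrite gt_eqF.
have ab0 : a ^+ 2 + b ^+ 2 != 0 by rewrite gt_eqF.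
exists ((a * c + b * d) / (cos t * (a ^+ 2 + b ^+ 2))).
  by rewrite divr_gt0 // mulr_gt0.
by rewrite st; split; field; rewrite ct0 ab0 Dn0.
Qed.

Lemma continuous_comp2 (U : topologicalType) (H : R -> R -> R) (f g : U -> R) x :
  continuous (fun p : R * R => H p.1 p.2) ->
  {for x, continuous f} -> {for x, continuous g} ->
  {for x, continuous (fun p => H (f p) (g p))}.
Proof.
by move=> cH cf cg; apply: continuous2_cvg cf cg; exact: (cH (f x, g x)).
Qed.

(** [F + i G] is the double-angle representation, in the frame given by the polar
    coordinates [(r, t)] on a hemisphere, of a field of tangent lines.  At the pole
    [r = 0] the field is constant and the frame turns once, hence the index [-2];
    on the equator [r = pi / 2] the frames at antipodal points differ by a
    reflection, hence the conjugation.  Cutting each circle into [2 n] small arcs,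
    the total variation of the angle is the sum [S r] of the arctangents of its
    increments; it is continuous in [r], satisfies [sin (S r) = 0], and moves from
    [- 4 pi] to [0], against the intermediate value theorem. *)
Lemma no_polar_field (F G : R -> R -> R) (A B : R) :
  continuous (fun p : R * R => F p.1 p.2) ->
  continuous (fun p : R * R => G p.1 p.2) ->
  (forall r t, 0 < F r t ^+ 2 + G r t ^+ 2) ->
  (forall r t, F r (t + 2 * pi) = F r t) ->
  (forall r t, G r (t + 2 * pi) = G r t) ->
  (forall t, F 0 t = A * cos (2 * t) + B * sin (2 * t)) ->
  (forall t, G 0 t = - A * sin (2 * t) + B * cos (2 * t)) ->
  (forall t, F (pi / 2) (t + pi) = F (pi / 2) t) ->
  (forall t, G (pi / 2) (t + pi) = - G (pi / 2) t) -> False.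
Proof.
move=> cF cG nz perF perG F0 G0 F1 G1.
have pi0 := pi_gt0 R.
pose dt r s t := F r s * F r t + G r s * G r t.
pose cr r s t := F r s * G r t - G r s * F r t.
have AB : 0 < A ^+ 2 + B ^+ 2.
  by have := nz 0 0; rewrite F0 G0 mulr0 cos0 sin0 !mulr0 !mulr1 addr0 add0r.
(* By compactness one mesh works for all circles: consecutive values of the field
   form an acute angle.  More than four steps per half turn keep the increments
   at the pole, [- 2 pi / n], in the range of the arctangent. *)
have [n n5 dpos] : exists2 n : nat, (4 < n)%N & forall r t : R,
    0 <= r <= pi / 2 -> 0 <= t <= 2 * pi -> 0 < dt r t (t + pi / n%:R).
  have /compact_near_coveringP cpt :
      compact (`[(0:R), pi / 2] `*` `[(0:R), 2 * pi]).
    by apply: compact_setX; exact: segment_compact.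
  have near_pos (x : R * R) : (`[(0:R), pi / 2] `*` `[(0:R), 2 * pi]) x ->
      \forall x' \near x & e \near nbhs (0 : R),
        0 < dt x'.1 x'.2 (x'.2 + e).
    case: x => r t _.
    have cd : {for ((r, t), (0:R)), continuous (fun q : (R * R) * R =>
       dt q.1.1 q.1.2 (q.1.2 + q.2))}.
      have c11 : {for ((r, t), (0:R)), continuous (fun q : (R * R) * R => q.1.1)}.
        by apply: (cvg_comp _ fst); [exact: cvg_fst|exact: cvg_fst].
      have c12 : {for ((r, t), (0:R)), continuous (fun q : (R * R) * R => q.1.2)}.
        by apply: (cvg_comp _ snd); [exact: cvg_fst|exact: cvg_snd].
      have c2 : {for ((r, t), (0:R)), continuous (fun q : (R * R) * R => q.1.2 + q.2)}.
        by apply: cvgD => //; exact: cvg_snd.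
      by apply: cvgD; apply: cvgM; apply: continuous_comp2.
    have := cvgr_gt _ cd 0; rewrite /= addr0 /dt -!expr2.
    by move=> /(_ _ (nz r t)); apply.
  have [e /= e0 He] := cpt _ _ _ _ near_pos.
  have [n n5 ne] : exists2 n : nat, (4 < n)%N & pi / e < n%:R.
    exists (maxn 5 (Num.bound (pi / e))); first by rewrite leq_max.
    apply: (lt_le_trans (archi_boundP _)); first by rewrite divr_ge0 ?ltW.
    by rewrite ler_nat leq_maxr.
  have n0 : (0 < n%:R :> R) by rewrite ltr0n (ltn_trans _ n5).
  exists n => // r t hr ht; apply: (He (pi / n%:R) _ (r, t)) => /=.
    rewrite /= sub0r normrN ger0_norm ?divr_ge0 ?ltW //.
    by rewrite ltr_pdivrMr // mulrC -ltr_pdivrMr.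
  by rewrite !in_itv.
pose D : R := pi / n%:R.
have n0 : (0 < n%:R :> R) by rewrite ltr0n (ltn_trans _ n5).
have D0 : 0 < D by rewrite divr_gt0.
(* Signed angle from the value at the i-th point of the circle to the next one. *)
pose tau r i :=
  atan (cr r (i%:R * D) (i.+1%:R * D) / dt r (i%:R * D) (i.+1%:R * D)).
pose S r k := \sum_(i < k) tau r i.
have dp (r : R) i : 0 <= r <= pi / 2 -> (i < 2 * n)%N ->
    0 < dt r (i%:R * D) (i.+1%:R * D).
  move=> hr hi; rewrite -natr1 mulrDl mul1r; apply: dpos => //.
  rewrite mulr_ge0 ?ler0n ?(ltW D0) //= /D mulrA ler_pdivrMr // mulrAC ler_pM2r //.
  by rewrite -natrM ler_nat ltnW.
(* The partial sums of the increments follow the argument of the field. *)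
have turn (r : R) k : 0 <= r <= pi / 2 -> (k <= 2 * n)%N ->
  exists2 rho : R, 0 < rho &
  F r (k%:R * D) = rho * (F r 0 * cos (S r k) - G r 0 * sin (S r k)) /\
  G r (k%:R * D) = rho * (F r 0 * sin (S r k) + G r 0 * cos (S r k)).
  move=> hr; elim: k => [|k IH] hk.
    exists 1 => //; rewrite /S big_ord0 cos0 sin0 mul0r !mul1r !mulr1 !mulr0.
    by rewrite subr0 add0r.
  have [rho rho0 [e1 e2]] := IH (ltnW hk).
  have [sg sg0] := rotation_by_atan (dp r k hr hk).
  rewrite -/(cr r (k%:R * D) (k.+1%:R * D)) -/(dt r (k%:R * D) (k.+1%:R * D)).
  rewrite -/(tau r k) => -[e3 e4].
  exists (sg * rho); first exact: mulr_gt0.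
  rewrite e3 e4 e1 e2 /S big_ord_recr /= -/(S r k) cosD sinD.
  by split; ring.
have sinS (r : R) : 0 <= r <= pi / 2 -> sin (S r (2 * n)%N) = 0.
  move=> hr; have [rho rho0 [e1 e2]] := turn r _ hr (leqnn _).
  have nD : (2 * n)%:R * D = 2 * pi.
    by rewrite natrM /D; field; rewrite gt_eqF.
  rewrite nD -[2 * pi]add0r perF perG in e1 e2.
  have : rho * (F r 0 ^+ 2 + G r 0 ^+ 2) * sin (S r (2 * n)%N) = 0.
    set a := S r (2 * n)%N.
    transitivity (F r 0 * (rho * (F r 0 * sin a + G r 0 * cos a)) -
                  G r 0 * (rho * (F r 0 * cos a - G r 0 * sin a))).
      by ring.
    by rewrite -e1 -e2; ring.
  by move/eqP; rewrite mulf_eq0 gt_eqF ?mulr_gt0 //= => /eqP.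
have S0 : S 0 (2 * n)%N = - (4 * pi).
  have tau0 i : tau 0 i = - (2 * D).
    rewrite /tau -[RHS]tanK; last first.
      have n5R : 4 < n%:R :> R by rewrite ltr_nat.
      have D2 : 2 * D < pi / 2 by rewrite /D mulrA ltr_pdivrMr //; nra.
      by rewrite in_itv /=; apply/andP; split; lra.
    congr atan; rewrite /tan sinN cosN /dt /cr !F0 !G0.
    set u := 2 * (i%:R * D).
    have -> : 2 * (i.+1%:R * D) = u + 2 * D by rewrite /u -natr1; ring.
    set v := u + 2 * D.
    have -> : 2 * D = v - u by rewrite /v; ring.
    rewrite sinB cosB.
    have -> : (A * cos u + B * sin u) * (- A * sin v + B * cos v) -
      (- A * sin u + B * cos u) * (A * cos v + B * sin v) =
       (A ^+ 2 + B ^+ 2) * - (sin v * cos u - cos v * sin u) by ring.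
    have -> : (A * cos u + B * sin u) * (A * cos v + B * sin v) +
      (- A * sin u + B * cos u) * (- A * sin v + B * cos v) =
       (A ^+ 2 + B ^+ 2) * (cos v * cos u + sin v * sin u) by ring.
    by rewrite -mulf_div divff ?gt_eqF // mul1r.
  rewrite /S (eq_bigr (fun=> - (2 * D))) // sumr_const card_ord.
  by rewrite -[_ *+ (2 * n)]mulr_natr natrM /D; field; rewrite gt_eqF.
have S1 : S (pi / 2) (2 * n)%N = 0.
  rewrite /S mul2n -addnn big_split_ord /= -big_split /= big1 // => i _.
  have nD : n%:R * D = pi by rewrite /D mulrC mulfVK // gt_eqF.
  have e k : (n + k)%:R * D = k%:R * D + pi by rewrite natrD mulrDl nD addrC.
  rewrite /tau -addnS !e [X in _ + atan X](_ : _ =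
    - (cr (pi / 2) (i%:R * D) (i.+1%:R * D) /
       dt (pi / 2) (i%:R * D) (i.+1%:R * D))) ?atanN ?subrr //.
  by rewrite /cr /dt !F1 !G1 -[RHS]mulNr; congr (_ / _); ring.
have cS : {within `[(0:R), pi / 2], continuous (fun r => S r (2 * n)%N)}.
  apply: continuous_in_subspaceT => r; rewrite inE /= in_itv /= => hr.
  rewrite /S; apply: cvg_big => [|i _]; first exact: add_continuous.
  have c t : {for r, continuous (fun r => F r t)}.
    apply: (continuous_comp2 cF (f := id) (g := fun=> t)).
      exact: cvg_id.
    exact: cvg_cst.
  have c' t : {for r, continuous (fun r => G r t)}.
    apply: (continuous_comp2 cG (f := id) (g := fun=> t)).
      exact: cvg_id.
    exact: cvg_cst.
  apply: (cvg_comp _ atan); last exact: continuous_atan.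
  apply: cvgM.
    by apply: cvgB; apply: cvgM; do [exact: c | exact: c'].
  have d0 : dt r (i%:R * D) (i.+1%:R * D) != 0 by rewrite gt_eqF // dp.
  by apply: (cvgV d0); apply: cvgD; apply: cvgM; do [exact: c | exact: c'].
have [c] : exists2 c : R, c \in `[0, pi / 2] & S c (2 * n)%N = - (pi / 2).
  apply: IVT => //.
    by rewrite divr_ge0 // ltW.
  by rewrite S0 S1 min_l ?max_r; lra.
rewrite in_itv /= => hc Sc; have := sinS c hc; rewrite Sc sinN sin_pihalf.
lra.
Qed.
End Winding.

(** * Rotations with a prescribed fixed vector *)

Section Axis.
Variable R : realType.
Local Notation V := 'rV[R]_5.

(** Matrices act on row vectors.  An isometry of the hyperplane [w^perp] is encoded
    by its extension fixing [w], so that all hyperplanes share one space of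
    matrices. *)
Definition turns (w zeta : V) (s : R) (M : 'M[R]_5) :=
  [/\ M *m M^T = 1%:M, \det M = 1, w *m M = w & zeta *m M = s *: zeta].

Lemma mulmx_tr_dot (m p n : nat) (P : 'M[R]_(m, n)) (Q : 'M[R]_(p, n)) i j :
  (P *m Q^T) i j = dot (row i P) (row j Q).
Proof. by rewrite mxE dotE; apply: eq_bigr => k _; rewrite !mxE. Qed.

(** In the orthonormal frame [(w, zeta, x, e, f)] the last three vectors span an
    invariant space, on which [M] has determinant [s]; the hypotheses on [e] and
    [f] are the vanishing of the double-angle representation of the axis. *)
Lemma turns_fixed (w zeta x e f : V) (s : R) (M : 'M[R]_5) :
  turns w zeta s M -> s ^+ 2 = 1 ->
  [/\ dot w w = 1, dot zeta zeta = 1, dot x x = 1, dot e e = 1 & dot f f = 1] ->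
  [/\ dot w zeta = 0, dot x w = 0, dot x zeta = 0, dot e w = 0
    & dot e zeta = 0] ->
  [/\ dot f w = 0, dot f zeta = 0, dot e x = 0, dot f x = 0 & dot e f = 0] ->
  dot (e *m M) e = dot (f *m M) f -> dot (e *m M) f = - dot (f *m M) e ->
  x *m M = s *: x.
Proof.
case=> oM dM wM zM s1 [ww zz xx ee ff] [wz xw xz ew ez] [fw fz ex fx ef] h1 h2.
have s0 : s * s = 1 by rewrite -expr2.
have perp u : dot u zeta = 0 -> dot (u *m M) zeta = 0.
  move=> uz; have := dot_mulmx u zeta oM; rewrite zM dotZr uz => /eqP.
  by rewrite mulf_eq0 => /orP[/eqP s00|/eqP //]; move: s1; rewrite s00; lra.
have perpw u : dot u w = 0 -> dot (u *m M) w = 0.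
  by move=> uw; have := dot_mulmx u w oM; rewrite wM uw.
pose Q1 : 'M[R]_(2, 5) := \matrix_(i < 2) [:: w; zeta]`_i.
pose Q2 : 'M[R]_(3, 5) := \matrix_(i < 3) [:: x; e; f]`_i.
pose D : 'M[R]_2 := diag_mx (\row_i [:: 1; s]`_i).
have dD : \det D = s by rewrite det_diag !big_ord_recl big_ord0 !mxE /= mulr1 mul1r.
have [||||||oA dA] := @det_compression R 2 3 Q1 Q2 M D.
- apply/matrixP => i j; rewrite mulmx_tr_dot !rowK mxE.
  by case: i j => [[|[|i]] hi] [[|[|j]] hj] //=; rewrite // dotC.
- apply/matrixP => i j; rewrite mulmx_tr_dot !rowK mxE.
  by case: i j => [[|[|[|i]]] hi] [[|[|[|j]]] hj] //=; rewrite // dotC.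
- apply/matrixP => i j; rewrite mulmx_tr_dot !rowK mxE.
  by case: i j => [[|[|i]] hi] [[|[|[|j]]] hj] //=; rewrite // dotC.
- exact: oM.
- apply/row_matrixP => i; rewrite !row_mul row_diag_mx -scalemxAl -rowE !rowK mxE.
  by case: i => [[|[|i]] hi] //=; rewrite ?wM ?zM ?scale1r.
- apply/matrixP => i j; rewrite mulmx_tr_dot row_mul !rowK mxE.
  by case: i j => [[|[|[|i]]] hi] [[|[|j]] hj] //=; rewrite (perpw, perp).
have AE i j : (Q2 *m M *m Q2^T) i j = dot ([:: x; e; f]`_i *m M) [:: x; e; f]`_j.
  by rewrite mulmx_tr_dot row_mul !rowK.
have dA' : \det (Q2 *m M *m Q2^T) = s.
  by rewrite -[LHS]mul1r -s0 -mulrA -[X in X * \det _]dD dA dM mulr1.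
have := so3_fixed_coordinate oA dA' s1; rewrite !AE /= => /(_ h1 h2) xMx.
apply/eqP; rewrite -subr_eq0 -dot_eq0 !dotP dot_mulmx // xMx.
rewrite (dotC x) xMx xx; apply/eqP; move: s0; lra.
Qed.

End Axis.

Section MatrixContinuity.
Context (R : realType) (T : Type) (F : set_system T) {FF : Filter F}.

Lemma cvg_mx (m n : nat) (f : T -> 'M[R]_(m, n)) (M : 'M[R]_(m, n)) :
  (forall i j, f t i j @[t --> F] --> M i j) -> f t @[t --> F] --> M.
Proof.
move=> fM A [P MP PA].
have : \forall t \near F, forall i j, P i j (f t i j).
  by apply: filter_forall => i; apply: filter_forall => j; exact: (fM i j).
by apply: filterS => t Pt; exact: PA.
Qed.

Lemma cvg_mx_entry (m n : nat) (f : T -> 'M[R]_(m, n)) (M : 'M[R]_(m, n)) i j :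
  f t @[t --> F] --> M -> f t i j @[t --> F] --> M i j.
Proof.
move=> fM; apply: (cvg_comp _ (fun N : 'M[R]_(m, n) => N i j) fM).
exact: coord_continuous.
Qed.

Lemma cvg_sum (I : Type) (r : seq I) (P : pred I) (f : I -> T -> R) (l : I -> R) :
  (forall i, f i t @[t --> F] --> l i) ->
  \sum_(i <- r | P i) f i t @[t --> F] --> \sum_(i <- r | P i) l i.
Proof.
by move=> fl; apply: cvg_big => [|i _]; [exact: add_continuous|exact: fl].
Qed.

Lemma cvg_prod (I : Type) (r : seq I) (P : pred I) (f : I -> T -> R) (l : I -> R) :
  (forall i, f i t @[t --> F] --> l i) ->
  \prod_(i <- r | P i) f i t @[t --> F] --> \prod_(i <- r | P i) l i.
Proof.
by move=> fl; apply: cvg_big => [|i _]; [exact: mul_continuous|exact: fl].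
Qed.

Lemma cvg_mulmx (m n p : nat) (f : T -> 'M[R]_(m, n)) (g : T -> 'M[R]_(n, p))
    (A : 'M[R]_(m, n)) (B : 'M[R]_(n, p)) :
  f t @[t --> F] --> A -> g t @[t --> F] --> B ->
  f t *m g t @[t --> F] --> A *m B.
Proof.
move=> fA gB; apply: cvg_mx => i j; rewrite mxE.
under eq_fun do rewrite mxE.
by apply: cvg_sum => k; apply: cvgM; apply: cvg_mx_entry.
Qed.

Lemma cvg_trmx (m n : nat) (f : T -> 'M[R]_(m, n)) (A : 'M[R]_(m, n)) :
  f t @[t --> F] --> A -> (f t)^T @[t --> F] --> A^T.
Proof.
move=> fA; apply: cvg_mx => i j; rewrite mxE; under eq_fun do rewrite mxE.
exact: cvg_mx_entry.
Qed.

Lemma cvg_det (n : nat) (f : T -> 'M[R]_n) (A : 'M[R]_n) :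
  f t @[t --> F] --> A -> \det (f t) @[t --> F] --> \det A.
Proof.
move=> fA; apply: cvg_sum => s; apply: cvgM; first exact: cvg_cst.
by apply: cvg_prod => i; apply: cvg_mx_entry.
Qed.

Lemma cvg_dot (n : nat) (f g : T -> 'rV[R]_n) (x y : 'rV[R]_n) :
  f t @[t --> F] --> x -> g t @[t --> F] --> y ->
  dot (f t) (g t) @[t --> F] --> dot x y.
Proof.
by move=> fx gy; apply: cvg_mx_entry; apply: cvg_mulmx => //; exact: cvg_trmx.
Qed.

End MatrixContinuity.

Section ExistsAxis.
Variable R : realType.
Local Notation V := 'rV[R]_5.

(** Otherwise the projections to [x^perp] of the axes would be a nowhere vanishing
    field of lines tangent to the unit sphere of the orthogonal complement of
    [zeta] and [x].  Here [w r t] are polar coordinates with pole [c], [e] and [f]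
    are the coordinate frame, and [Fz], [Gz] the double-angle representation of the
    field, up to a positive factor. *)
Lemma exists_fixing_turn (zeta x : V) (Phi : V -> 'M[R]_5) (s : R) :
  dot zeta zeta = 1 -> dot x x = 1 -> dot x zeta = 0 -> s ^+ 2 = 1 ->
  (forall w, w != 0 -> dot w zeta = 0 -> turns w zeta s (Phi w)) ->
  (forall w, Phi (- w) = Phi w) ->
  (forall g : R * R -> V, continuous g ->
    (forall p, g p != 0 /\ dot (g p) zeta = 0) ->
    continuous (fun p => Phi (g p))) ->
  exists w, [/\ w != 0, dot w zeta = 0, dot w x = 0 & x *m Phi w = s *: x].
Proof.
move=> zz xx xz s1 tPhi PhiN cPhi.
have [a aa /= a_] := @orthogonal_direction_seq R 5 [:: zeta; x] isT.
have [b bb /= b_] := @orthogonal_direction_seq R 5 [:: zeta; x; a] isT.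
have [c cc /= c_] := @orthogonal_direction_seq R 5 [:: zeta; x; a; b] isT.
have [az ax] : dot a zeta = 0 /\ dot a x = 0.
  by rewrite !(dotC a) !a_ ?inE ?eqxx ?orbT.
have [bz bx ba] : [/\ dot b zeta = 0, dot b x = 0 & dot b a = 0].
  by rewrite !(dotC b) !b_ ?inE ?eqxx ?orbT.
have [cz cx] : dot c zeta = 0 /\ dot c x = 0.
  by rewrite !(dotC c) !c_ ?inE ?eqxx ?orbT.
have [ca cb] : dot c a = 0 /\ dot c b = 0.
  by rewrite !(dotC c) !c_ ?inE ?eqxx ?orbT.
have [ab [ac bc]] : dot a b = 0 /\ dot a c = 0 /\ dot b c = 0.
  by rewrite (dotC a b) (dotC a c) (dotC b c).
have [h hE] : exists h : R -> V, forall t, h t = cos t *: a + sin t *: b.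
  by exists (fun t => cos t *: a + sin t *: b).
have [f fE] : exists f : R -> V, forall t, f t = - sin t *: a + cos t *: b.
  by exists (fun t => - sin t *: a + cos t *: b).
pose w (r t : R) : V := sin r *: h t + cos r *: c.
pose e (r t : R) : V := cos r *: h t - sin r *: c.
have cs (t : R) : cos t * cos t + sin t * sin t = 1 by rewrite -!expr2 cos2Dsin2.
have dots := (az, ax, bz, bx, ba, cz, cx, ca, cb, ab, ac, bc, aa, bb, cc, zz, xx, xz).
have hh t : dot (h t) (h t) = 1.
  by rewrite hE !dotP !dots; move: (cs t); lra.
have ff t : dot (f t) (f t) = 1.
  by rewrite fE !dotP !dots; move: (cs t); lra.
have hf t : dot (h t) (f t) = 0 by rewrite hE fE !dotP !dots; ring.
have hz t : dot (h t) zeta = 0 by rewrite hE !dotP !dots; ring.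
have hx t : dot (h t) x = 0 by rewrite hE !dotP !dots; ring.
have hc t : dot (h t) c = 0 by rewrite hE !dotP !dots; ring.
have fz t : dot (f t) zeta = 0 by rewrite fE !dotP !dots; ring.
have fx t : dot (f t) x = 0 by rewrite fE !dotP !dots; ring.
have fc t : dot (f t) c = 0 by rewrite fE !dotP !dots; ring.
have ww r t : dot (w r t) (w r t) = 1.
  by rewrite /w !dotP (dotC c (h t)) hc hh !dots; move: (cs r); lra.
have wz r t : dot (w r t) zeta = 0 by rewrite /w !dotP hz !dots; ring.
have wx r t : dot (w r t) x = 0 by rewrite /w !dotP hx !dots; ring.
have w0 r t : w r t != 0 by rewrite -dot_eq0 ww oner_eq0.
have ee r t : dot (e r t) (e r t) = 1.
  by rewrite /e !dotP (dotC c (h t)) hc hh !dots; move: (cs r); lra.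
have ez r t : dot (e r t) zeta = 0 by rewrite /e !dotP hz !dots; ring.
have ex r t : dot (e r t) x = 0 by rewrite /e !dotP hx !dots; ring.
have ew r t : dot (e r t) (w r t) = 0.
  by rewrite /e /w !dotP (dotC c (h t)) hc hh !dots; ring.
have ef r t : dot (e r t) (f t) = 0.
  by rewrite /e !dotP hf (dotC c (f t)) fc; ring.
have fw r t : dot (f t) (w r t) = 0.
  by rewrite /w !dotP (dotC _ (h t)) hf fc; ring.
apply: contrapT => noaxis.
pose M r t := Phi (w r t).
pose Fz r t := dot (e r t *m M r t) (e r t) - dot (f t *m M r t) (f t).
pose Gz r t := dot (e r t *m M r t) (f t) + dot (f t *m M r t) (e r t).
have nz r t : 0 < Fz r t ^+ 2 + Gz r t ^+ 2.
  rewrite lt_neqAle addr_ge0 ?sqr_ge0 // andbT eq_sym paddr_eq0 ?sqr_ge0 //.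
  apply/negP; rewrite !sqrf_eq0 subr_eq0 addr_eq0 => /andP[/eqP F0 /eqP G0].
  apply: noaxis; exists (w r t); split => //.
  apply: (turns_fixed (tPhi _ (w0 r t) (wz r t)) s1 _ _ _ F0 G0); split=> //.
  by rewrite dotC.
have ccos (p : R * R) : {for p, continuous (fun p : R * R => cos p.2)}.
  by apply: (cvg_comp _ cos); [exact: cvg_snd|exact: continuous_cos].
have csin (p : R * R) : {for p, continuous (fun p : R * R => sin p.2)}.
  by apply: (cvg_comp _ sin); [exact: cvg_snd|exact: continuous_sin].
have ccos1 (p : R * R) : {for p, continuous (fun p : R * R => cos p.1)}.
  by apply: (cvg_comp _ cos); [exact: cvg_fst|exact: continuous_cos].
have csin1 (p : R * R) : {for p, continuous (fun p : R * R => sin p.1)}.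
  by apply: (cvg_comp _ sin); [exact: cvg_fst|exact: continuous_sin].
have ch (p : R * R) : {for p, continuous (fun p : R * R => h p.2)}.
  have -> : h = (fun t => cos t *: a + sin t *: b) by apply/funext => t; rewrite hE.
  apply: cvgD; apply: cvgZ; try exact: cvg_cst; [exact: ccos|exact: csin].
have cf (p : R * R) : {for p, continuous (fun p : R * R => f p.2)}.
  have -> : f = (fun t => - sin t *: a + cos t *: b) by apply/funext => t; rewrite fE.
  apply: cvgD; apply: cvgZ; try exact: cvg_cst; [apply: cvgN; exact: csin|exact: ccos].
have cw : continuous (fun p : R * R => w p.1 p.2).
  move=> p; apply: cvgD; apply: cvgZ; try exact: cvg_cst.
  - exact: csin1.
  - exact: ch.
  - exact: ccos1.
have ce (p : R * R) : {for p, continuous (fun p : R * R => e p.1 p.2)}.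
  apply: cvgB; apply: cvgZ; try exact: cvg_cst.
  - exact: ccos1.
  - exact: ch.
  - exact: csin1.
have cM : continuous (fun p : R * R => M p.1 p.2) by apply: cPhi.
apply: (@no_polar_field R Fz Gz
  (dot (a *m Phi c) a - dot (b *m Phi c) b)
  (dot (a *m Phi c) b + dot (b *m Phi c) a)) => //.
- move=> p; apply: cvgB; apply: cvg_dot; try apply: cvg_mulmx;
    by do [exact: ce | exact: cf | exact: cM].
- move=> p; apply: cvgD; apply: cvg_dot; try apply: cvg_mulmx;
    by do [exact: ce | exact: cf | exact: cM].
- move=> r t; rewrite /Fz /M /w /e !hE !fE.
  by rewrite mulr_natl cosD2pi sinD2pi.
- move=> r t; rewrite /Gz /M /w /e !hE !fE.
  by rewrite mulr_natl cosD2pi sinD2pi.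
- move=> t; rewrite /Fz /M /w /e !hE !fE sin0 cos0 !scale0r !scale1r add0r subr0.
  rewrite !mulmxDl -!scalemxAl !dotP mulr_natl mulr2n cosD sinD; ring.
- move=> t; rewrite /Gz /M /w /e !hE !fE sin0 cos0 !scale0r !scale1r add0r subr0.
  rewrite !mulmxDl -!scalemxAl !dotP mulr_natl mulr2n cosD sinD; ring.
- move=> t; rewrite /Fz /M /w /e !hE !fE sin_pihalf cos_pihalf sinDpi cosDpi.
  rewrite (_ : - cos t *: a + - sin t *: b = - (cos t *: a + sin t *: b));
    last by rewrite opprD !scaleNr.
  rewrite (_ : - - sin t *: a + - cos t *: b = - (- sin t *: a + cos t *: b));
    last by rewrite opprD !scaleNr.
  rewrite !scale0r !scale1r !add0r !addr0 PhiN !mulNmx.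
  by rewrite !(dotNl, dotNr); ring.
- move=> t; rewrite /Gz /M /w /e !hE !fE sin_pihalf cos_pihalf sinDpi cosDpi.
  rewrite (_ : - cos t *: a + - sin t *: b = - (cos t *: a + sin t *: b));
    last by rewrite opprD !scaleNr.
  rewrite (_ : - - sin t *: a + - cos t *: b = - (- sin t *: a + cos t *: b));
    last by rewrite opprD !scaleNr.
  rewrite !scale0r !scale1r !add0r !addr0 PhiN !mulNmx.
  by rewrite !(dotNl, dotNr); ring.
Qed.

End ExistsAxis.

(** * Star bodies and limits of congruences *)

Lemma closed_mx_set1 (R : realType) (m n : nat) (A : 'M[R]_(m, n)) :
  closed [set A].
Proof.
apply: compact_closed; last exact: compact_set1.
exact: (@norm_hausdorff R 'M[R]_(m, n)).
Qed.

Section StarBodies.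
Variables (R : realType) (n : nat).
Local Notation V := 'rV[R]_n.
Implicit Types (K L : set V).

Lemma star_body_closed K : star_body K -> closed K.
Proof. by case=> -[_ _ ->] _ _; exact: closed_closure. Qed.

Lemma star_body_segment K y t : star_body K -> K y -> 0 <= t <= 1 -> K (t *: y).
Proof.
case=> _ [_ st] _ Ky t01; apply: (st y Ky); exists t => //.
by rewrite scaler0 add0r.
Qed.

Lemma star_body_bounded_line K x : star_body K -> x != 0 ->
  exists B, forall c, K (c *: x) -> `|c| <= B.
Proof.
case=> -[cK _ _] _ _ x0; have [M [_ /(_ (M + 1))]] := compact_bounded cK.
rewrite ltrDl ltr01 => /(_ isT) MK; have nx : 0 < `|x| by rewrite normr_gt0.
exists ((M + 1) / `|x|) => c /MK; rewrite /= normrZ ler_pdivlMr //.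
Qed.

Lemma star_body_radial K x c : star_body K -> x != 0 -> K (c *: x) ->
  c <= radial K x.
Proof.
move=> sK x0 Kc; have [B hB] := star_body_bounded_line sK x0.
apply: sup_upper_bound => //; split; first by exists c.
by exists B => d /= /hB; apply: le_trans; exact: ler_norm.
Qed.

(** This is what continuity of the radial function is for: near [t *: y] it stays
    larger than one. *)
Lemma star_body_interior K y t : star_body K -> K y -> 0 <= t < 1 ->
  interior K (t *: y).
Proof.
move=> sK Ky /andP[t0 t1]; have [[_ _ _] [K0 _] cK] := sK.
have [->|ty0] := eqVneq (t *: y) 0; first exact: K0.
have tn0 : t != 0 by apply: contraNneq ty0 => ->; rewrite scale0r.
have y0 : y != 0 by apply: contraNneq ty0 => ->; rewrite scaler0.
have tp : 0 < t by rewrite lt_neqAle eq_sym tn0.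
have r1 : 1 < radial K (t *: y).
  apply: (lt_le_trans _ (star_body_radial (c := t^-1) sK ty0 _)).
    by rewrite invf_gt1.
  by rewrite scalerA mulVf // scale1r.
have op : open (~` [set (0 : V)]) by exact/closed_openC/closed_mx_set1.
have cy : {for t *: y, continuous (radial K)}.
  move: cK; rewrite continuous_open_subspace // => /(_ (t *: y)); apply.
  by rewrite inE /=; apply/eqP.
have rn : \forall z \near t *: y, 1 < radial K z by exact: (cvgr_gt _ cy).
rewrite /interior /=; apply: filterS rn => z /= rz.
have [|d] := @sup_gt _ [set c | K (c *: z)] 1 _ rz.
  by exists 0; rewrite /= scale0r; exact: interior_subset.
rewrite /= => Kd d1; have d0 : 0 < d by apply: lt_trans d1.
have -> : z = d^-1 *: (d *: z) by rewrite scalerA mulVf ?scale1r // gt_eqF.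
apply: star_body_segment => //; rewrite invr_ge0 ltW //=.
by rewrite invf_le1 // ltW.
Qed.

End StarBodies.

Section OrthogonalCompact.
Variable R : realType.

Lemma compact_orthogonal n : compact [set M : 'M[R]_n | M *m M^T = 1%:M].
Proof.
pose B := [set v : 'rV[R]_(n * n) | forall i, v ord0 i \in `[(-1 : R), 1]].
have cB : compact B.
  by apply: (@rV_compact _ _ (fun=> `[(-1 : R), 1]%classic)) => _; exact: segment_compact.
have cvec : continuous (@vec_mx R n n).
  move=> v; apply: (@cvg_mx R _ (nbhs v) _) => i j; rewrite mxE.
  under eq_fun do rewrite mxE.
  exact: cvg_mx_entry.
apply: (subclosed_compact _ (continuous_compact (continuous_subspaceT cvec) cB)).
  have -> : [set M : 'M[R]_n | M *m M^T = 1%:M] =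
      (fun M => M *m M^T) @^-1` [set 1%:M] by [].
  apply: preimage_closed => [M _|]; last exact: closed_mx_set1.
  have cT : @trmx R n n N @[N --> M] --> M^T.
    exact: (@cvg_trmx R _ (nbhs M) _ n n id M cvg_id).
  exact: (@cvg_mulmx R _ (nbhs M) _ n n n id trmx M M^T cvg_id cT).
move=> M /= oM; exists (mxvec M); last exact: mxvecK.
move=> k; case/mxvec_indexP: k => i j; rewrite mxvecE in_itv /= -ler_norml.
rewrite -(@expr_le1 _ 2) // real_normK ?num_real //.
have /matrixP/(_ i i) := oM; rewrite !mxE eqxx mulr1n => <-.
rewrite (bigD1 j) //= mxE -expr2 lerDl sumr_ge0 // => k _.
by rewrite mxE -expr2 sqr_ge0.
Qed.

End OrthogonalCompact.

Section Graph.
Variable R : realType.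
Local Notation V := 'rV[R]_5.

(** One of the two inclusions in a congruence of sections by [w^perp]; a congruence
    is this inclusion for a matrix together with that for its inverse, which makes
    the passage to the limit symmetric. *)
Definition maps_section (n : nat) (K L : set 'rV[R]_n) w (M : 'M[R]_n) a :=
  forall y, dot y w = 0 -> K y -> L (y *m M - a).

(** A point [t *: y], [t < 1], of the limit section is interior to [K], hence its
    orthogonal projections to the nearby hyperplanes are points of their sections.
    Their images converge, and [L] is closed; then let [t] tend to one. *)
Lemma maps_section_limit (n : nat) (K L : set 'rV[R]_n) (T : Type)
    (F : set_system T) (w : T -> 'rV[R]_n) (M : T -> 'M[R]_n) (a : T -> 'rV[R]_n)
    (w0 : 'rV[R]_n) (M0 : 'M[R]_n) (a0 : 'rV[R]_n) :
  ProperFilter F -> star_body K -> closed L -> w0 != 0 ->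
  w t @[t --> F] --> w0 -> M t @[t --> F] --> M0 -> a t @[t --> F] --> a0 ->
  (\forall t \near F, w t != 0 /\ maps_section K L (w t) (M t) (a t)) ->
  maps_section K L w0 M0 a0.
Proof.
move=> FF sK cL w00 cw cM ca mapsF y yw Ky.
have inner t : 0 <= t < 1 -> L ((t *: y) *m M0 - a0).
  move=> t01; have iK := star_body_interior sK Ky t01.
  pose p i := t *: y - (dot (t *: y) (w i) / dot (w i) (w i)) *: w i.
  have cp : p i @[i --> F] --> t *: y.
    have -> : t *: y = t *: y - (dot (t *: y) w0 / dot w0 w0) *: w0.
      by rewrite dotZl yw mulr0 mul0r scale0r subr0.
    apply: cvgB; first exact: cvg_cst.
    apply: cvgZ => //; apply: cvgM; first by apply: cvg_dot => //; exact: cvg_cst.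
    by apply: cvgV; [rewrite dot_eq0|apply: cvg_dot].
  apply: (closed_cvg _ cL _ _ (cvgB (cvg_mulmx cp cM) ca)).
  near=> i; have [wi0 mi] : w i != 0 /\ maps_section K L (w i) (M i) (a i).
    by near: i.
  apply: mi; last by near: i; apply: cp.
  by rewrite dotBl [X in _ - X]dotZl mulfVK ?dot_eq0 // subrr.
have cN : (1 - (k.+1%:R)^-1) *: y *m M0 - a0 @[k --> \oo] --> y *m M0 - a0.
  apply: cvgB; last exact: cvg_cst.
  apply: cvg_mulmx; last exact: cvg_cst.
  rewrite -[X in _ --> X]scale1r; apply: cvgZ; last exact: cvg_cst.
  rewrite -[X in _ --> X]subr0; apply: cvgB; first exact: cvg_cst.
  exact: cvg_harmonic.
apply: (closed_cvg _ cL _ _ cN); apply: nearW => k; apply: inner.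
by rewrite subr_ge0 invf_le1 ?ltr0n // ler1n /= ltrBlDr ltrDl invr_gt0 ltr0n.
Unshelve. all: by end_near. Qed.

End Graph.

Lemma cvg_near_eq (R : realType) (m n : nat) (T : Type) (F : set_system T)
    (f g : T -> 'M[R]_(m, n)) (A B : 'M[R]_(m, n)) : ProperFilter F ->
  f t @[t --> F] --> A -> g t @[t --> F] --> B ->
  (\forall t \near F, f t = g t) -> A = B.
Proof.
move=> FF fA gB fg; apply/eqP; rewrite -subr_eq0; apply/eqP.
have cl : closed [set (0 : 'M[R]_(m, n))] := @closed_mx_set1 R m n 0.
apply: (closed_cvg _ cl _ _ (cvgB fA gB)).
apply: filterS fg => t e /=.
by rewrite -[LHS]/(f t - g t) e subrr.
Qed.

Section Matched.
Context (R : realType) (K L : set 'rV[R]_5) (zeta : 'rV[R]_5) (al be : R).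
Hypotheses (starK : star_body K) (starL : star_body L).
Local Notation V := 'rV[R]_5.

(** For the matrices of interest this is the sign [s] with [zeta M = s zeta].  As a
    function of [M] it is continuous, which gives its constancy later. *)
Definition axis_sign (M : 'M[R]_5) : R := dot (zeta *m M) zeta.

(** The translation along [zeta] takes only two values, one for each sign.  The
    affine expression through these values makes it continuous in [M]. *)
Definition axis_shift (M : 'M[R]_5) : V := (al + be * axis_sign M) *: zeta.

Definition matched (w : V) (M : 'M[R]_5) :=
  [/\ axis_sign M ^+ 2 = 1, turns w zeta (axis_sign M) M,
      maps_section K L w M (axis_shift M)
    & maps_section L K w M^T (- (axis_shift M *m M^T))].

Lemma matched_limit (T : Type) (F : set_system T) (w : T -> V)
    (M : T -> 'M[R]_5) (w0 : V) (M0 : 'M[R]_5) :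
  ProperFilter F -> w0 != 0 -> w t @[t --> F] --> w0 -> M t @[t --> F] --> M0 ->
  (\forall t \near F, w t != 0 /\ matched (w t) (M t)) -> matched w0 M0.
Proof.
move=> FF w00 cw cM mF.
have csgn : axis_sign (M t) @[t --> F] --> axis_sign M0.
  apply: cvg_dot; last exact: cvg_cst.
  by apply: cvg_mulmx => //; exact: cvg_cst.
have cshift : axis_shift (M t) @[t --> F] --> axis_shift M0.
  apply: cvgZ; last exact: cvg_cst.
  apply: cvgD; first exact: cvg_cst.
  by apply: cvgM => //; exact: cvg_cst.
have cMT : (M t)^T @[t --> F] --> M0^T by exact: cvg_trmx.
have s1 : axis_sign M0 ^+ 2 = 1.
  have cl : closed [set x : R | x = 1] by exact: closed_eq.
  apply: (closed_cvg _ cl _ _ (cvgM csgn csgn)).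
  by apply: filterS mF => t [_ []].
split => //.
- split.
  + apply: (@cvg_near_eq R 5 5 T F (fun t => M t *m (M t)^T) (fun=> 1%:M) _ _ FF).
    * exact: (cvg_mulmx cM cMT).
    * exact: cvg_cst.
    by apply: filterS mF => t [_ [_ []]].
  + have cl : closed [set x : R | x = 1] by exact: closed_eq.
    apply: (closed_cvg _ cl _ _ (cvg_det cM)).
    by apply: filterS mF => t [_ [_ []]].
  + apply: (@cvg_near_eq R 1 5 T F (fun t => w t *m M t) w _ _ FF) => //.
    * exact: cvg_mulmx.
    by apply: filterS mF => t [_ [_ []]].
  + apply: (@cvg_near_eq R 1 5 T F (fun t => zeta *m M t)
      (fun t => axis_sign (M t) *: zeta) _ _ FF).
    * by apply: cvg_mulmx => //; exact: cvg_cst.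
    * by apply: cvgZ => //; exact: cvg_cst.
    by apply: filterS mF => t [_ [_ []]].
- apply: (maps_section_limit FF starK _ w00 cw cM cshift).
    exact: star_body_closed.
  by apply: filterS mF => t [? []].
- apply: (maps_section_limit FF starL _ w00 cw cMT
      (cvgN (cvg_mulmx cshift cMT))).
    exact: star_body_closed.
  by apply: filterS mF => t [? []].
Qed.

(** The graph of [matched] is closed: otherwise the matched pairs near [(w0, M0)]
    would form a proper filter, and [matched_limit] would apply to it. *)
Lemma unmatched_near (I : Type) (G : set_system I) (w : I -> V) (w0 : V)
    (M0 : 'M[R]_5) :
  Filter G -> w0 != 0 -> w i @[i --> G] --> w0 -> (forall i, w i != 0) ->
  ~ matched w0 M0 -> \forall M \near M0 & i \near G, ~ matched (w i) M.
Proof.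
move=> FG w00 cw wn0 nM; apply: contrapT => nnear; apply: nM.
pose H := filter_prod (nbhs M0) G.
have FH : Filter H by exact: filter_prod_filter.
pose A := [set p : 'M[R]_5 * I | matched (w p.2) p.1].
have PF : ProperFilter (within A H).
  apply: Build_ProperFilter_ex => B BH; apply: contrapT => nB; apply: nnear.
  have BH' : H (fun p => A p -> B p) := BH.
  apply: filterS BH' => -[M i] /= AB mi; apply: nB.
  by exists (M, i); exact: AB.
apply: (@matched_limit _ (within A H) (fun p => w p.2) fst w0 M0 PF w00).
- apply: cvg_trans cw => X GX.
  have HX : H (fun p => X (w p.2)) by exact: (@cvg_snd _ _ (nbhs M0) G _ _ GX).
  suff : H (fun p => A p -> X (w p.2)) by [].
  by apply: filterS HX => p Xp _.
- move=> X MX; have HX : H (fun p => X p.1) by exact: (@cvg_fst _ _ (nbhs M0) G _ _ MX).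
  suff : H (fun p => A p -> X p.1) by [].
  by apply: filterS HX => p Xp _.
- suff : H (fun p => A p -> w p.2 != 0 /\ matched (w p.2) p.1) by [].
  by apply: filterE => -[M i].
Qed.

(** Otherwise every matrix of the compact orthogonal group would have a
    neighbourhood unmatched near [w0], and finitely many of them cover the group. *)
Lemma limit_exists_matched (u : nat -> V) (w0 : V) :
  w0 != 0 -> u i @[i --> \oo] --> w0 -> (forall i, u i != 0) ->
  (forall i, exists M, matched (u i) M) -> exists M, matched w0 M.
Proof.
move=> w00 cu u0 mu; apply: contrapT => nM.
have /compact_near_coveringP cpt := @compact_orthogonal R 5.
have [N _ hN] : \forall i \near \oo,
    [set M : 'M[R]_5 | M *m M^T = 1%:M] `<=` (fun M => ~ matched (u i) M).
  apply: cpt => M _; apply: (unmatched_near _ w00 cu u0) => mM.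
  by apply: nM; exists M.
have [M mM] := mu N; apply: (hN N _ M) => //=.
by case: mM => _ [].
Qed.

(** Closed graph theorem with values in the compact orthogonal group, stated along
    a continuous family since the hypotheses only hold on part of the space. *)
Lemma continuous_matched (Phi : V -> 'M[R]_5) :
  (forall w M M', w != 0 -> dot w zeta = 0 -> matched w M -> matched w M' ->
    M = M') ->
  (forall w, w != 0 -> dot w zeta = 0 -> matched w (Phi w)) ->
  forall (T : topologicalType) (g : T -> V), continuous g ->
  (forall p, g p != 0 /\ dot (g p) zeta = 0) -> continuous (fun p => Phi (g p)).
Proof.
move=> uniq mPhi T g cg gp p U nU.
have /compact_near_coveringP cpt := @compact_orthogonal R 5.
have [gp0 gpz] := gp p.
have : \forall q \near p,
    [set M : 'M[R]_5 | M *m M^T = 1%:M] `<=` (fun M => matched (g q) M -> U M).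
  apply: cpt => M _; have [mM|nM] := pselect (matched (g p) M).
    have nUM : nbhs M U by rewrite (uniq _ _ _ gp0 gpz mM (mPhi _ gp0 gpz)).
    have HU : \forall N \near M & q \near p, U N.
      by exact: (@cvg_fst _ _ (nbhs M) (nbhs p) _ U nUM).
    by apply: filterS HU => -[N q].
  have : \forall N \near M & q \near p, ~ matched (g q) N.
    by apply: (unmatched_near _ gp0 (cg p) _ nM) => q; case: (gp q).
  by apply: filterS => -[N q] /= nN /nN.
apply: filterS => q hq; have [gq0 gqz] := gp q.
have mq := mPhi _ gq0 gqz.
have oM : Phi (g q) *m (Phi (g q))^T = 1%:M by case: mq => _ [].
exact: (hq _ oM mq).
Qed.

End Matched.

(** * Isometries of a hyperplane as matrices *)

Section HyperplaneEndomorphisms.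
Variables (R : realType) (n : nat) (w : 'rV[R]_n).
Hypothesis w0 : w != 0.
Local Notation H := (hyperplane_orth w).
Implicit Types (f : 'End(subvs_of H)) (M : 'M[R]_n).

Lemma dim_hyperplane_orth : (\dim H).+1 = n.
Proof.
have := limg_ker_dim (linfun (mulmxr w^T)) (fullv : {vspace 'rV[R]_n}).
rewrite capfv dimvf (_ : dim _ = n); last by rewrite dim_matrix; exact: mul1n.
move=> dn; rewrite -[RHS]dn; rewrite -addn1; congr addn.
apply/esym/eqP; rewrite eqn_leq; apply/andP; split.
  by apply: leq_trans (dimvS (subvf _)) _; rewrite dimvf dim_matrix.
rewrite lt0n dimv_eq0; apply/negP => /eqP im0.
have : linfun (mulmxr w^T) w \in (linfun (mulmxr w^T) @: fullv)%VS.
  by apply: memv_img; exact: memvf.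
rewrite im0 memv0 lfunE /= => /eqP/matrixP/(_ 0 0).
by rewrite -[LHS]/(dot w w) [RHS]mxE => /eqP; rewrite dot_eq0 (negbTE w0).
Qed.

(** Completing a basis of the hyperplane by [w] makes the matrix of [M] block
    diagonal, with the matrix of [f] and the scalar one as blocks. *)
Lemma det_hyperplane_extension f M :
  (forall u, vsval u *m M = vsval (f u)) -> w *m M = w -> lfun_det f = \det M.
Proof.
move=> fM wM; rewrite /lfun_det; set e := vbasis _.
have eB : basis_of fullv e by exact: vbasisP.
set F := passmx.mxof e e f.
pose B := \matrix_(i < \dim (fullv : {vspace subvs_of H})) vsval e`_i.
have BE v : v *m B = vsval (passmx.vecof e v).
  rewrite mulmx_sum_row /passmx.vecof linear_sum.
  by apply: eq_bigr => i _; rewrite rowK linearZ.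
have BM : B *m M = F *m B.
  apply/row_matrixP => i; rewrite !rowE !mulmxA !BE fM.
  by rewrite (passmx.hom_vecof _ eB).
have Bw : B *m w^T = 0.
  apply/row_matrixP => i; rewrite rowE mulmxA BE row0.
  have := subvsP (passmx.vecof e (delta_mx 0 i)).
  rewrite mem_hyperplane_orth => /eqP d.
  by apply/matrixP => a b; rewrite !ord1 [RHS]mxE.
have Binj (v : 'rV_(\dim (fullv : {vspace subvs_of H}))) : v *m B = 0 -> v = 0.
  rewrite BE -[RHS]/(vsval (0 : subvs_of H)) => /val_inj/eqP.
  by rewrite (passmx.vecof_eq0 eB) => /eqP.
have dn : (\dim (fullv : {vspace subvs_of H}) + 1)%N = n.
  by rewrite dimvf addn1; exact: dim_hyperplane_orth.
clearbody F; clearbody B; clear fM BE eB; clear e f.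
move: (\dim _) dn F B BM Bw Binj => d dn F B BM Bw Binj.
(* The dimension of the hyperplane plus one is only provably equal to [n]. *)
case: _ / dn w w0 M wM B BM Bw Binj => v v0 M vM B BM Bw Binj.
pose C := col_mx B v.
have CM : C *m M = block_mx F 0 0 1%:M *m C.
  by rewrite /C mul_col_mx mul_block_col BM vM !mul0mx mul1mx addr0 add0r.
have uC : C \in unitmx.
  rewrite -row_free_unit -kermx_eq0; apply/rowV0P => x /sub_kermxP.
  rewrite -[x]hsubmxK mul_row_col => xC.
  have r0 : rsubmx x = 0.
    have := congr1 (mulmxr v^T) xC; rewrite /= mulmxDl -!mulmxA Bw mulmx0 add0r.
    rewrite mul0mx [v *m _]mx11_scalar -/(dot v v) mul_mx_scalar => /eqP.
    by rewrite scaler_eq0 dot_eq0 (negbTE v0) => /eqP.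
  move: xC; rewrite r0 mul0mx addr0 => /Binj ->.
  by rewrite row_mx0.
have /(congr1 determinant) := CM; rewrite !det_mulmx det_ublock det1 mulr1 => e.
by apply: (@mulIf _ (\det C)); rewrite -?e 1?mulrC // -unitfE -unitmxE.
Qed.

Lemma orthogonal_mulmxP M :
  (forall x y, dot (x *m M) (y *m M) = dot x y) -> M *m M^T = 1%:M.
Proof.
move=> oM; apply/matrixP => i j; rewrite mulmx_tr_dot !rowE oM.
rewrite -[delta_mx 0 i]mulmx1 -[delta_mx 0 j]mulmx1 -!rowE -mulmx_tr_dot.
by rewrite trmx1 mulmx1.
Qed.

(** The matrix is that of the extension of the isometry which fixes [w]. *)
Lemma directly_congruent_matrix (K L : set 'rV[R]_n) :
  directly_congruent H (section K H) (section L H) ->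
  exists M, exists a, [/\ M *m M^T = 1%:M, \det M = 1, w *m M = w, dot a w = 0
    & forall y, dot y w = 0 -> (K y <-> L (y *m M - a))].
Proof.
case=> f [a [[orf df] aH fKL]]; have d0 : dot w w != 0 by rewrite dot_eq0.
have HP y : (y \in H) = (dot y w == 0) by exact: mem_hyperplane_orth.
pose P : 'M[R]_n := 1%:M - (dot w w)^-1 *: (w^T *m w).
have PE y : y *m P = y - (dot y w / dot w w) *: w.
  rewrite mulmxBr mulmx1 -scalemxAr mulmxA [y *m _]mx11_scalar mul_scalar_mx.
  by rewrite scalerA mulrC.
have PH y : y *m P \in H.
  by rewrite PE HP dotBl dotZl mulfVK // subrr.
pose g := lin1_mx (vsval \o f \o vsproj H).
have gE y : y *m g = vsval (f (vsproj H y)) by rewrite mul_rV_lin1.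
pose M := P *m g + (dot w w)^-1 *: (w^T *m w).
have ME y : y *m M = vsval (f (vsproj H (y *m P))) + (dot y w / dot w w) *: w.
  rewrite mulmxDr mulmxA gE -scalemxAr mulmxA [y *m w^T]mx11_scalar.
  by rewrite mul_scalar_mx scalerA [_^-1 * _]mulrC.
have fM u : vsval u *m M = vsval (f u).
  have /eqP uw : dot (vsval u) w == 0 by rewrite -HP; exact: subvsP.
  by rewrite ME PE uw mul0r !scale0r subr0 addr0 vsvalK.
have wM : w *m M = w.
  by rewrite ME PE divff // scale1r subrr !linear0 add0r.
have MH y : dot y w = 0 -> y *m M = vsval (f (vsproj H y)).
  by move=> yw; rewrite -fM vsprojK // HP yw.
have oM : M *m M^T = 1%:M.
  apply: orthogonal_mulmxP => x y; rewrite !ME.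
  set x' := x *m P; set y' := y *m P.
  have fw u : dot (vsval (f u)) w = 0.
    by apply/eqP; rewrite -HP; exact: subvsP.
  rewrite !(dotDl, dotDr, dotZl, dotZr) !fw !(dotC w) !fw orf !vsprojK ?PH //.
  by rewrite /x' /y' !PE !dotP !(dotC w); field.
exists M, a; split=> //.
- by rewrite -(det_hyperplane_extension fM wM).
- by apply/eqP; rewrite -HP.
- move=> y yw; split=> [Ky|Ly].
  + have : translate (section L H) a (y *m M).
      rewrite -fKL; exists (vsproj H y); last by rewrite MH.
      by rewrite /= vsprojK ?HP ?yw //; split => //=; rewrite HP yw.
    by case=> z [Lz _] <-; rewrite addrK.
  + have : endo_image f (section K H) (y *m M).
      rewrite fKL; exists (y *m M - a); last by rewrite subrK.
      split => //=; rewrite rpredB // MH //; exact: subvsP.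
    case=> u [Ku _] /=; rewrite -fM => uy.
    suff -> : y = vsval u by [].
    by rewrite -[y]mulmx1 -oM mulmxA -uy -mulmxA oM mulmx1.
Qed.

Lemma matrix_SO_symmetry (K : set 'rV[R]_n) (N : 'M[R]_n) (a : 'rV[R]_n) :
  N *m N^T = 1%:M -> \det N = 1 -> w *m N = w -> dot a w = 0 -> N != 1%:M ->
  (forall y, dot y w = 0 -> (K y <-> K (y *m N - a))) ->
  has_SO_symmetry H (section K H).
Proof.
move=> oN dN wN aw N1 KN.
have HP y : (y \in H) = (dot y w == 0) by exact: mem_hyperplane_orth.
pose f : 'End(subvs_of H) := linfun (vsproj H \o mulmxr N \o vsval).
have NH y : y \in H -> y *m N \in H.
  by rewrite !HP => yw; rewrite -[w]wN dot_mulmx.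
have fN u : vsval u *m N = vsval (f u).
  by rewrite lfunE /= vsprojK // NH // subvsP.
exists f, a; split.
- split; last by rewrite (det_hyperplane_extension fN wN).
  by move=> u v; rewrite -!fN dot_mulmx.
- move=> f1; move/eqP: N1; apply; apply/row_matrixP => i.
  rewrite !rowE mulmx1; move: (delta_mx _ _) => y.
  pose u := y - (dot y w / dot w w) *: w.
  have uH : u \in H by rewrite HP /u dotBl dotZl mulfVK ?dot_eq0 // subrr.
  have uN : u *m N = u by rewrite -(vsprojK uH) fN f1 lfunE.
  by rewrite -[y](subrK ((dot y w / dot w w) *: w)) -/u mulmxDl uN -scalemxAl wN.
- by rewrite HP aw.
- apply/seteqP; split => y /=.
    case=> u [/= Ku _] <-; exists (vsval u *m N - a); last by rewrite subrK fN.
    have /eqP uw : dot (vsval u) w == 0 by rewrite -HP; exact: subvsP.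
    split; first exact/(KN _ uw).
    by rewrite /= rpredB //; [apply: NH; exact: subvsP|rewrite HP aw].
  case=> z [Kz /= zH] <-; pose y' := (z + a) *m N^T.
  have y'w : dot y' w = 0.
    rewrite dot_mulmx_tr trmxK wN dotDl aw addr0.
    by apply/eqP; rewrite -HP.
  have y'H : y' \in H by rewrite HP y'w.
  have y'N : y' *m N = z + a by rewrite -mulmxA (mulmx1C oN) mulmx1.
  exists (vsproj H y'); last by rewrite -fN vsprojK.
  rewrite /= vsprojK //; split => //; apply/KN => //.
  by rewrite y'N addrK.
Qed.

End HyperplaneEndomorphisms.

(** * Generic hyperplanes *)

Section CountableAvoidance.
Variable R : realType.

Lemma finite_set_root (p : {poly R}) : p != 0 -> finite_set [set t | root p t].
Proof.
move=> p0; apply: contrapT => /(infinite_set_fset (size p)) [B BA].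
rewrite leqNgt => /negP; apply; apply: max_poly_roots => //.
  by apply/allP => t tB; exact: (BA t tB).
exact: finmap.fset_uniq.
Qed.

Lemma countable_avoid (A : set R) (e : R) : countable A -> 0 < e ->
  exists2 t, 0 < t < e & ~ A t.
Proof.
move=> cA e0; apply: contrapT => nA.
have sA : `]0, e[%classic `<=` A.
  move=> t; rewrite /= in_itv /= => te; apply: contrapT => At.
  by apply: nA; exists t.
have := countable_lebesgue_measure0 (sub_countable (subset_card_le sA) cA).
by rewrite lebesgue_measure_itv /= lte_fin e0 sube0 => -[/eqP]; rewrite gt_eqF.
Qed.

(** Perturb [w0] along the projection to [zeta^perp] of the moment curve
    [(t, t^2, ..., t^n)].  For each [z] of [Z] the inner product with [z] is a
    nonzero polynomial in [t], so all of them are nonzero off a countable set of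
    parameters, which misses arbitrarily small ones. *)
Lemma approx_avoiding_hyperplanes (n : nat) (zeta w0 : 'rV[R]_n)
    (Z : set 'rV[R]_n) :
  dot zeta zeta = 1 -> w0 != 0 -> dot w0 zeta = 0 -> countable Z ->
  (forall z, Z z -> ~ parallel z zeta) ->
  exists u : nat -> 'rV[R]_n, u i @[i --> \oo] --> w0 /\
    forall i, [/\ u i != 0, dot (u i) zeta = 0 & forall z, Z z -> dot (u i) z != 0].
Proof.
move=> zz w00 w0z cZ Zz.
pose proj (v : 'rV[R]_n) := v - dot v zeta *: zeta.
have projz v : dot (proj v) zeta = 0 by rewrite dotBl dotZl zz mulr1 subrr.
have projC v v' : dot (proj v) v' = dot v (proj v').
  by rewrite dotBl dotBr dotZl dotZr (dotC zeta v') mulrC.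
pose c t : 'rV[R]_n := \row_i t ^+ i.+1.
pose w t := w0 + proj (c t).
pose p z : {poly R} := rVpoly (proj z) * 'X + (dot w0 z)%:P.
have pE z t : (p z).[t] = dot (w t) z.
  rewrite hornerMXaddC dotDl addrC; congr (_ + _).
  rewrite projC dotE horner_poly mulr_suml; apply: eq_bigr => i _.
  by rewrite valK [c t 0 i]mxE exprSr -mulrA mulrC.
have p0 z : ~ parallel z zeta -> p z != 0.
  move=> nz; rewrite -size_poly_eq0 size_MXaddC.
  case: ifP => //= /andP[/eqP q0 _]; exfalso; apply: nz; exists (dot z zeta).
  by apply/eqP; rewrite -subr_eq0 -/(proj z) -[proj z]rVpolyK q0 linear0.
have nw0 : ~ parallel w0 zeta.
  case=> t e; move: w0z; rewrite e dotZl zz mulr1 => t0.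
  by move: w00; rewrite e t0 scale0r eqxx.
(* Avoiding the roots for [w0] itself, which is not parallel to [zeta], keeps the
   perturbed vectors nonzero. *)
pose bad := \bigcup_(b in [set: bool]) if b then [set t | root (p w0) t]
  else \bigcup_(z in Z) [set t | root (p z) t].
have cbad : countable bad.
  have fc z : ~ parallel z zeta -> countable [set t | root (p z) t].
    by move=> nz; apply: finite_set_countable; apply: finite_set_root; exact: p0.
  apply: bigcup_countable => [|[] _]; [exact: countableP|exact: fc|].
  by apply: bigcup_countable => // z /Zz; exact: fc.
have /choice[t tP] : forall i : nat, exists t, 0 < t < i.+1%:R^-1 /\ ~ bad t.
  move=> i; have [|t] := countable_avoid (e := i.+1%:R^-1) cbad.
    by rewrite invr_gt0 ltr0n.
  by exists t.
have t0 : t i @[i --> \oo] --> (0 : R).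
  apply: (@squeeze_cvgr _ _ _ _ (fun=> 0) (fun i => i.+1%:R^-1)).
  - by apply: nearW => i; have [/andP[? ?] _] := tP i; rewrite !ltW.
  - exact: cvg_cst.
  - exact: cvg_harmonic.
exists (fun i => w (t i)); split.
  have cc : c (t i) @[i --> \oo] --> (0 : 'rV[R]_n).
    apply: cvg_mx => j k; rewrite mxE; under eq_fun do rewrite mxE.
    have -> : (0 : R) = 0 ^+ k.+1 by rewrite expr0n.
    by apply: (cvg_comp t (fun x => x ^+ k.+1) t0); exact: exprn_continuous.
  have -> : w0 = w0 + (0 - dot 0 zeta *: zeta).
    by rewrite dot0l scale0r subr0 addr0.
  apply: cvgD; first exact: cvg_cst.
  apply: cvgB => //; apply: cvgZ; last exact: cvg_cst.
  by apply: cvg_dot => //; exact: cvg_cst.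
move=> i; have [_ ti] := tP i; split.
- apply/eqP => wt0; apply: ti; exists true => //.
  by rewrite /= /root pE wt0 dot0l.
- by rewrite dotDl w0z projz addr0.
- move=> z Zz'; apply/eqP => wz; apply: ti; exists false => //; exists z => //.
  by rewrite /= /root pE wz.
Qed.

End CountableAvoidance.

Section CentralDiameter.
Variable R : realType.
Local Notation V := 'rV[R]_5.

(** Reads off a translation along a line from its effect on the end of the
    section. *)
Lemma radial_translate (n : nat) (K L : set 'rV[R]_n) (x y : 'rV[R]_n) (c : R) :
  star_body K -> star_body L -> x != 0 -> y != 0 ->
  (forall t, K (t *: x) <-> L ((t - c) *: y)) -> radial K x = radial L y + c.
Proof.
move=> sK sL x0 y0 KL.
have zero (S : set 'rV[R]_n) : star_body S -> S 0.
  by case=> _ [S0 _] _; exact: interior_subset.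
apply/eqP; rewrite eq_le -lerBlDr; apply/andP; split.
  rewrite lerBlDr; apply: ge_sup; first by exists 0; rewrite /= scale0r; exact: zero.
  by move=> t /= /KL Lt; rewrite -lerBlDr; exact: star_body_radial.
rewrite -lerBrDr; apply: ge_sup; first by exists 0; rewrite /= scale0r; exact: zero.
move=> t /= Lt; rewrite lerBrDr; apply: star_body_radial => //.
by apply/KL; rewrite addrK.
Qed.

Lemma enorm_mulmx (n : nat) (M : 'M[R]_n) x : M *m M^T = 1%:M ->
  enorm (x *m M) = enorm x.
Proof. by move=> oM; rewrite /enorm dot_mulmx. Qed.

Lemma segment_affine (n : nat) (x y a : 'rV[R]_n) (M : 'M[R]_n) p :
  segment (x *m M + a) (y *m M + a) p ->
  exists2 q, segment x y q & p = q *m M + a.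
Proof.
case=> t t01 <-; exists ((1 - t) *: x + t *: y); first by exists t.
rewrite mulmxDl -!scalemxAl !scalerDr addrACA -scalerDl subrK.
by rewrite scale1r.
Qed.

Lemma segment_perp (n : nat) (x y w p : 'rV[R]_n) :
  dot x w = 0 -> dot y w = 0 -> segment x y p -> dot p w = 0.
Proof. by move=> xw yw [t _ <-]; rewrite dotDl !dotZl xw yw !mulr0 addr0. Qed.

Lemma segmentL (n : nat) (x y : 'rV[R]_n) : segment x y x.
Proof. by exists 0; rewrite /= ?lexx ?ler01 // subr0 scale1r scale0r addr0. Qed.

Lemma segmentR (n : nat) (x y : 'rV[R]_n) : segment x y y.
Proof. by exists 1; rewrite /= ?lexx ?ler01 // subrr scale1r scale0r add0r. Qed.

Lemma central_diameter_coordinates (n : nat) (K : set 'rV[R]_n) (zeta : 'rV[R]_n) :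
  star_body K -> enorm zeta = 1 -> has_central_diameter K zeta ->
  exists p q : R, p != q /\ diameter_ends K (p *: zeta) (q *: zeta).
Proof.
move=> sK nz [x [y [[xyK dm] [lam yx] [t t01 t0]]]].
have ex : x = (- (t * lam)) *: zeta.
  have : x + t *: (y - x) = 0.
    by rewrite -t0 scalerBr scalerBl scale1r addrA addrAC.
  by rewrite yx scalerA scaleNr => /eqP; rewrite addr_eq0 => /eqP.
have ey : y = (lam - t * lam) *: zeta by rewrite scalerBl -yx -scaleNr -ex subrK.
exists (- (t * lam)), (lam - t * lam); rewrite -ex -ey; split=> //.
apply/eqP => e; have lam0 : lam = 0 by lra.
have [K0 _] : star_shaped K 0 by case: sK.
have [d d0 Kd] : exists2 d : R, 0 < d & K (d *: zeta).
  have cz : (d *: zeta) @[d --> (0 : R)] --> (0 : 'rV[R]_n).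
    rewrite -[X in _ --> X](scale0r zeta); apply: cvgZ; last exact: cvg_cst.
    exact: cvg_id.
  have /nbhs_ballP[e' /= e0 he] := cz _ K0.
  exists (e' / 2); first by rewrite divr_gt0.
  apply: (he (e' / 2)); rewrite /ball /= sub0r normrN ger0_norm; lra.
have := dm 0 (d *: zeta); rewrite -(opprB y x) yx lam0 scale0r oppr0.
rewrite sub0r -scaleNr /enorm dotZl dotZr dot0l sqrtr0 (enorm1_dot nz).
rewrite mulr1 mulrNN -expr2 sqrtr_sqr (ger0_norm (ltW d0)) => H.
have : d <= 0.
  apply: H => z [s s01 <-]; rewrite scaler0 add0r.
  exact: star_body_segment.
lra.
Qed.

Section Sections.
Variables (K L : set V) (zeta : V).
Hypotheses (starK : star_body K) (starL : star_body L).
Hypotheses (unit_zeta : enorm zeta = 1).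

Definition congruent_section (w : V) (M : 'M[R]_5) (a : V) :=
  [/\ M *m M^T = 1%:M, \det M = 1, w *m M = w, dot a w = 0
    & forall y, dot y w = 0 -> (K y <-> L (y *m M - a))].

Hypothesis congKL : forall w, w != 0 -> dot w zeta = 0 ->
  exists M a, congruent_section w M a.

Lemma congruent_section_perp w M a y : congruent_section w M a ->
  dot y w = 0 -> dot (y *m M) w = 0.
Proof. by case=> oM _ wM _ _ yw; rewrite -wM dot_mulmx. Qed.

(** In dimension five some hyperplane contains [zeta] and a given segment of [L]; the
    congruence on it moves the segment into [K]. *)
Lemma diameter_upper_bound x y u v : diameter_ends K x y ->
  segment u v `<=` L -> enorm (u - v) <= enorm (x - y).
Proof.
move=> [_ dm] uvL.
have [w ww /= w_] := @orthogonal_direction_seq R 5 [:: zeta; u; v] isT.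
have w0 : w != 0 by rewrite -dot_eq0 ww oner_eq0.
have wz : dot w zeta = 0 by rewrite dotC w_ ?inE ?eqxx.
have uw : dot u w = 0 by rewrite w_ ?inE ?eqxx ?orbT.
have vw : dot v w = 0 by rewrite w_ ?inE ?eqxx ?orbT.
have [M [a [oM _ wM aw KL]]] := congKL w0 wz.
have oM' := mulmx1C oM.
have <- : enorm (u *m M^T + a *m M^T - (v *m M^T + a *m M^T)) = enorm (u - v).
  rewrite opprD addrACA subrr addr0 -mulmxBl enorm_mulmx // trmxK //.
apply: dm => p /segment_affine[q uvq ->]; have qw := segment_perp uw vw uvq.
have pw : dot (q *m M^T + a *m M^T) w = 0.
  by rewrite -mulmxDl dot_mulmx_tr trmxK wM dotDl qw aw addr0.
apply/(KL _ pw); rewrite mulmxDl -!mulmxA oM' !mulmx1 addrK.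
exact: uvL.
Qed.

(* [al + be * s] is [radial K (s *: zeta) - radial L zeta] for [s = 1] and
   [s = -1]: the congruence carries the end of [K] in the direction [s *: zeta] to
   the end of [L] in the direction [zeta]. *)
Let al := (radial K zeta + radial K (- zeta)) / 2 - radial L zeta.
Let be := (radial K zeta - radial K (- zeta)) / 2.

(** The image of the central diameter of [K] is a diameter of [L] by
    [diameter_upper_bound], so it lies on the line of [zeta] when [w] is
    generic. *)
Lemma generic_matched p q w M a :
  p != q -> diameter_ends K (p *: zeta) (q *: zeta) ->
  w != 0 -> dot w zeta = 0 -> congruent_section w M a ->
  (forall D, diameters L D -> D `<=` [set z | dot z w = 0] ->
    D `<=` [set z | parallel z zeta]) ->
  matched K L zeta al be w M.
Proof.
move=> pq dK w0 wz cs good; have zz := enorm1_dot unit_zeta.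
have zw k : dot (k *: zeta) w = 0 by rewrite dotZl dotC wz mulr0.
have perp := congruent_section_perp cs; case: cs => oM dM wM aw KL.
have imL y : segment (p *: zeta) (q *: zeta) y -> L (y *m M - a).
  by move=> py; apply/KL; [exact: segment_perp py|exact: (proj1 dK)].
pose D := segment ((p *: zeta) *m M - a) ((q *: zeta) *m M - a).
have DL : D `<=` L by move=> z /segment_affine[y /imL ? ->].
have Dw : D `<=` [set z | dot z w = 0].
  move=> z /segment_affine[y py ->]; rewrite /= dotBl aw subr0 perp //.
  exact: segment_perp py.
have dD : diameters L D.
  exists ((p *: zeta) *m M - a), ((q *: zeta) *m M - a); split=> //; split=> // u v uvL.
  apply: le_trans (diameter_upper_bound dK uvL) _.
  by rewrite opprB addrA subrK -mulmxBl enorm_mulmx.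
have Dz := good D dD Dw.
have [lp Elp] := Dz _ (segmentL _ _); have [lq Elq] := Dz _ (segmentR _ _).
have [s zM] : exists s, zeta *m M = s *: zeta.
  exists ((lp - lq) / (p - q)).
  have pq0 : p - q != 0 by rewrite subr_eq0.
  apply: (scalerI pq0); rewrite scalerA mulrCA divff // mulr1 [RHS]scalerBl -Elp -Elq.
  by rewrite opprB addrA subrK -mulmxBl -scalerBl scalemxAl.
have s1 : s ^+ 2 = 1.
  by have := dot_mulmx zeta zeta oM; rewrite zM dotZl dotZr zz mulr1 -expr2.
have [c ac] : exists c, a = c *: zeta.
  exists (p * s - lp); rewrite scalerBl -Elp -scalemxAl zM scalerA.
  by rewrite opprB addrC subrK.
have z0 : zeta != 0 by rewrite -dot_eq0 zz oner_eq0.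
have s0 : s != 0 by apply/eqP => s0; move: s1; rewrite s0; lra.
have rc : radial K (s *: zeta) = radial L zeta + c.
  apply: radial_translate => //; first by rewrite scaler_eq0 negb_or s0.
  move=> t; rewrite scalerA KL // -scalemxAl zM scalerA ac -scalerBl.
  by rewrite -mulrA -expr2 s1 mulr1.
have sM : axis_sign zeta M = s by rewrite /axis_sign zM dotZl zz mulr1.
have shM : axis_shift zeta al be M = a.
  rewrite /axis_shift sM ac; congr (_ *: _); rewrite -[c](addKr (radial L zeta)) -rc.
  have /orP[/eqP ->|/eqP ->] : (s == 1) || (s == -1) by rewrite -sqrf_eq1 s1.
    by rewrite scale1r /al /be; field.
  by rewrite scaleN1r /al /be; field.
split; rewrite ?sM ?shM //; first by move=> y yw Ky; exact/KL.
move=> y yw Ly; rewrite opprK -mulmxDl; apply/KL.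
  by rewrite dot_mulmx_tr trmxK wM dotDl yw aw addr0.
by rewrite -mulmxA (mulmx1C oM) mulmx1 addrK.
Qed.

Lemma exists_matched w0 :
  countable (diameters L) -> has_central_diameter K zeta ->
  w0 != 0 -> dot w0 zeta = 0 -> exists M, matched K L zeta al be w0 M.
Proof.
move=> cL dK w00 w0z; have zz := enorm1_dot unit_zeta.
have [p [q [pq dpq]]] := central_diameter_coordinates starK unit_zeta dK.
pose off (D : set V) := D `\` [set z | parallel z zeta].
pose Z := (fun D => get (off D)) @` (diameters L `&` [set D | off D !=set0]).
have cZ : countable Z.
  apply: (sub_countable (card_image_le _ _)).
  by apply: (sub_countable _ cL); apply: subset_card_le => D [].
have Zz z : Z z -> ~ parallel z zeta.
  by case=> D [_ /= [y Dy]] <-; have [] := getPex (ex_intro _ y Dy).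
have [u [cu uP]] := approx_avoiding_hyperplanes zz w00 w0z cZ Zz.
apply: (limit_exists_matched starK starL w00 cu) => [i|i]; first by case: (uP i).
have [u0 uz uZ] := uP i; have [M [a cs]] := congKL u0 uz.
exists M; apply: (generic_matched pq dpq u0 uz cs) => D dD Du z Dz.
apply: contrapT => nz; have offD : off D !=set0 by exists z.
have := uZ (get (off D)) (imageP _ (conj dD offD)); rewrite dotC => /eqP; apply.
by apply: Du; have [] := getPex offD.
Qed.

End Sections.
End CentralDiameter.

(** * Gluing the congruences *)

Section MatchedTheory.
Variables (R : realType) (K L : set 'rV[R]_5) (zeta : 'rV[R]_5) (al be : R).
Local Notation V := 'rV[R]_5.
Local Notation matched := (matched K L zeta al be).

Lemma matchedN w : matched (- w) = matched w.
Proof.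
have half v M : matched v M -> matched (- v) M.
  case=> s1 [oM dM vM zM] KL LK; split=> //.
  - by split=> //; rewrite mulNmx vM.
  - by move=> y; rewrite dotNr => /eqP; rewrite oppr_eq0 => /eqP; exact: KL.
  - by move=> y; rewrite dotNr => /eqP; rewrite oppr_eq0 => /eqP; exact: LK.
apply/funext => M; apply/propext; split; last exact: half.
by move=> /half; rewrite opprK.
Qed.

Lemma matched_iff w M y : matched w M -> dot w zeta = 0 -> dot y w = 0 ->
  K y <-> L (y *m M - axis_shift zeta al be M).
Proof.
case=> _ [oM _ wM _] KL LK wz yw; split; first exact: KL.
move=> /LK; rewrite opprK mulmxBl subrK -mulmxA oM mulmx1; apply.
by rewrite dotBl -{1}wM dot_mulmx // yw /axis_shift dotZl dotC wz mulr0 subrr.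
Qed.

(** Up to a translation, [M M'^-1] preserves the section of [K]. *)
Lemma matched_unique w M M' : w != 0 -> dot w zeta = 0 ->
  ~ has_SO_symmetry (hyperplane_orth w) (section K (hyperplane_orth w)) ->
  matched w M -> matched w M' -> M = M'.
Proof.
move=> w0 wz nsym mM mM'; have [_ [oM dM wM _] _ _] := mM.
have [_ [oM' dM' wM' _] _ _] := mM'.
have oMt := mulmx1C oM'.
have [e|N1] := eqVneq (M *m M'^T) 1%:M.
  by rewrite -[M]mulmx1 -oMt mulmxA e mul1mx.
exfalso; apply: nsym.
pose b := (axis_shift zeta al be M - axis_shift zeta al be M') *m M'^T.
have bw : dot b w = 0.
  rewrite /b dot_mulmx_tr trmxK wM' /axis_shift dotBl !dotZl (dotC zeta) wz.
  by rewrite !mulr0 subrr.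
apply: (matrix_SO_symmetry w0 (N := M *m M'^T) (a := b)) => //.
- by rewrite trmx_mul trmxK mulmxA -(mulmxA M) oMt mulmx1.
- by rewrite det_mulmx det_tr dM dM' mulr1.
- by rewrite mulmxA wM -{1}wM' -mulmxA oM' mulmx1.
move=> y yw; rewrite (matched_iff mM wz yw).
rewrite (matched_iff (y := y *m (M *m M'^T) - b) mM' wz); last first.
  rewrite dotBl bw subr0 mulmxA dot_mulmx_tr trmxK wM' -{1}wM.
  by rewrite dot_mulmx.
rewrite /b mulmxBl -!mulmxA oMt !mulmx1.
by rewrite opprB -addrA addrAC subrr add0r.
Qed.

(** The sign is continuous along [cos^2 t v + sin^2 t w], which does not vanish once
    [w] has been replaced by [- w] if necessary. *)
Lemma sign_constant (Phi : V -> 'M[R]_5) :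
  (forall w, w != 0 -> dot w zeta = 0 -> matched w (Phi w)) ->
  (forall w, Phi (- w) = Phi w) ->
  (forall g : R -> V, continuous g ->
    (forall t, g t != 0 /\ dot (g t) zeta = 0) -> continuous (fun t => Phi (g t))) ->
  forall v w, v != 0 -> dot v zeta = 0 -> w != 0 -> dot w zeta = 0 ->
  axis_sign zeta (Phi v) = axis_sign zeta (Phi w).
Proof.
move=> mPhi PhiN cPhi v w v0 vz; wlog vw : w / 0 <= dot v w.
  move=> H w0 wz; have [/H|vw] := leP 0 (dot v w); first exact.
  rewrite -(PhiN w); apply: H; first by rewrite dotNr oppr_ge0 ltW.
    by rewrite oppr_eq0.
  by rewrite dotNl wz oppr0.
move=> w0 wz; pose g (t : R) : V := cos t ^+ 2 *: v + sin t ^+ 2 *: w.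
have gz t : dot (g t) zeta = 0 by rewrite dotDl !dotZl vz wz !mulr0 addr0.
have g0 t : g t != 0.
  rewrite -dot_eq0 /g !dotP (dotC w v) gt_eqF //.
  have := cos2Dsin2 t; move: (cos t ^+ 2) (sqr_ge0 (cos t)) => x x0.
  move: (sin t ^+ 2) (sqr_ge0 (sin t)) => y y0 xy.
  have := dot_gt0 v0; have := dot_gt0 w0; move: vw.
  move: (dot v w) (dot v v) (dot w w) => d a b d0 b0 a0.
  have xyd : 0 <= x * (y * d) by rewrite !mulr_ge0.
  have : 0 < x * (x * a) + y * (y * b).
    have [x1|x1] := ltP 0 x.
      by rewrite ltr_pwDl ?mulr_gt0 // !mulr_ge0 // ltW.
    have y1 : 0 < y by lra.
    by rewrite ltr_wpDl ?mulr_gt0 // !mulr_ge0 // ltW.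
  by move: xyd; rewrite mulrCA; lra.
have cg : continuous g.
  move=> t; apply: cvgD; apply: cvgZ; try exact: cvg_cst.
    by apply: cvgM; exact: continuous_cos.
  by apply: cvgM; exact: continuous_sin.
have cs : continuous (fun t => axis_sign zeta (Phi (g t))).
  move=> t; apply: cvg_dot; last exact: cvg_cst.
  by apply: cvg_mulmx; [exact: cvg_cst|apply: cPhi].
have sq t : axis_sign zeta (Phi (g t)) ^+ 2 = 1 by have [] := mPhi _ (g0 t) (gz t).
have gv : g 0 = v by rewrite /g cos0 sin0 expr0n expr1n scale1r scale0r addr0.
have gw : g (pi / 2) = w.
  by rewrite /g cos_pihalf sin_pihalf expr0n expr1n scale1r scale0r add0r.
have s0 := sq 0; have s1 := sq (pi / 2); rewrite gv in s0; rewrite gw in s1.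
apply/eqP; apply: contraT => ne.
have [t _ t0] : exists2 t, t \in `[(0 : R), pi / 2] & axis_sign zeta (Phi (g t)) = 0.
  apply: IVT; first by rewrite divr_ge0 ?pi_ge0.
    exact: continuous_subspaceT.
  rewrite gv gw; move: ne s0 s1.
  move: (axis_sign _ (Phi v)) (axis_sign _ (Phi w)) => x y ne /eqP + /eqP.
  rewrite !sqrf_eq1 => /orP[]/eqP ex /orP[]/eqP ey; move: ne;
    by rewrite ex ey ?eqxx // => _; rewrite ge_min le_max ler01 lerN10 ?orbT.
by have := sq t; rewrite t0; lra.
Qed.

(** Every [y] lies in a plane spanned by [zeta] and a unit vector [x] orthogonal to
    it; on the hyperplane given by [exists_fixing_turn], which contains this plane,
    the congruence multiplies [y] by [s]. *)
Lemma sections_match_globally :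
  star_body K -> star_body L -> dot zeta zeta = 1 ->
  (forall w, w != 0 -> dot w zeta = 0 -> exists M, matched w M) ->
  (forall w M M', w != 0 -> dot w zeta = 0 -> matched w M -> matched w M' ->
    M = M') ->
  exists s k : R, s ^+ 2 = 1 /\ forall y, K y <-> L (s *: y - k *: zeta).
Proof.
move=> sK sL zz exM uniq; pose Phi w := get (matched w).
have mPhi w : w != 0 -> dot w zeta = 0 -> matched w (Phi w).
  by move=> w0 wz; exact: getPex (exM w w0 wz).
have PhiN w : Phi (- w) = Phi w by rewrite /Phi matchedN.
have cPhi := continuous_matched sK sL uniq mPhi.
have [v vv /= v_] := @orthogonal_direction_seq R 5 [:: zeta] isT.
have vz : dot v zeta = 0 by rewrite dotC v_ ?inE.
have v0 : v != 0 by rewrite -dot_eq0 vv oner_eq0.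
pose s := axis_sign zeta (Phi v).
have sE w : w != 0 -> dot w zeta = 0 -> axis_sign zeta (Phi w) = s.
  by move=> w0 wz; apply: sign_constant => // g; exact: cPhi.
have s1 : s ^+ 2 = 1 by have [] := mPhi v v0 vz.
exists s, (al + be * s); split=> // y.
suff [w [w0 wz yw yM]] : exists w, [/\ w != 0, dot w zeta = 0, dot y w = 0
    & y *m Phi w = s *: y].
  by rewrite (matched_iff (mPhi w w0 wz) wz yw) yM /axis_shift sE.
have [x xx [xz [c yE]]] : exists2 x, dot x x = 1 & dot x zeta = 0 /\
    exists c, y = dot y zeta *: zeta + c *: x.
  pose x' := y - dot y zeta *: zeta.
  have x'z : dot x' zeta = 0 by rewrite dotBl dotZl zz mulr1 subrr.
  have [x0|x0] := eqVneq x' 0.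
    exists v => //; split=> //; exists 0; rewrite scale0r addr0.
    by apply/eqP; rewrite -subr_eq0; apply/eqP.
  have dx := dot_gt0 x0; have sx : Num.sqrt (dot x' x') != 0.
    by rewrite gt_eqF // sqrtr_gt0.
  exists ((Num.sqrt (dot x' x'))^-1 *: x').
    rewrite dotZl dotZr mulrA -expr2 exprVn sqr_sqrtr ?dot_ge0 // mulVf //.
    by rewrite gt_eqF.
  split; first by rewrite dotZl x'z mulr0.
  exists (Num.sqrt (dot x' x')); rewrite scalerA divff // scale1r.
  by rewrite addrC subrK.
have [|||w [w0 wz wx xM]] := @exists_fixing_turn R zeta x Phi s zz xx xz s1.
- by move=> w w0 wz; rewrite -(sE w) //; have [] := mPhi w w0 wz.
- exact: PhiN.
- by move=> g; exact: cPhi.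
exists w; split=> //; first by rewrite yE dotDl !dotZl !(dotC _ w) wz wx !mulr0 addr0.
have [_ [_ _ _ zM] _ _] := mPhi w w0 wz; rewrite sE // in zM.
rewrite yE mulmxDl -!scalemxAl zM xM scalerDr !scalerA.
by rewrite !(mulrC s).
Qed.

End MatchedTheory.

Theorem theorem2 (R : realType) (K L : set 'rV[R]_5) (zeta : 'rV[R]_5)
  (starK : star_body K) (starL : star_body L)
  (countK : countable (diameters K)) (countL : countable (diameters L))
  (unit_zeta : enorm zeta = 1)
  (diamK : has_central_diameter K zeta)
  (congKL : forall H : {vspace 'rV[R]_5}, \dim H = 4%N -> zeta \in H ->
    directly_congruent H (section K H) (section L H))
  (noSO4 : forall H : {vspace 'rV[R]_5}, \dim H = 4%N -> zeta \in H ->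
    ~ has_SO_symmetry H (section K H) /\ ~ has_SO_symmetry H (section L H))
  (noO3 : forall H : {vspace 'rV[R]_5}, \dim H = 4%N -> zeta \in H ->
    let G := (H :&: hyperplane_orth zeta)%VS in
    ~ has_O_symmetry G (section K G) /\ ~ has_O_symmetry G (section L G)) :
  exists b : 'rV[R]_5, parallel b zeta /\
    (K = translate L b \/ K = translate (reflect0 L) b).
Proof.
have zz := enorm1_dot unit_zeta.
have dimH (w : 'rV[R]_5) : w != 0 -> \dim (hyperplane_orth w) = 4%N.
  by move=> /dim_hyperplane_orth[].
have zH (w : 'rV[R]_5) : dot w zeta = 0 -> zeta \in hyperplane_orth w.
  by move=> wz; rewrite mem_hyperplane_orth dotC wz.
have cong (w : 'rV[R]_5) : w != 0 -> dot w zeta = 0 ->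
    exists M a, congruent_section K L w M a.
  move=> w0 wz.
  have [M [a [oM dM wM aw KL]]] :=
    directly_congruent_matrix w0 (congKL _ (dimH w w0) (zH w wz)).
  by exists M, a.
have exM w w0 wz := @exists_matched R K L zeta starK starL unit_zeta cong w
  countL diamK w0 wz.
have [|s [k [s1 KL]]] := sections_match_globally starK starL zz exM.
  move=> w M M' w0 wz; apply: matched_unique => //.
  by case: (noSO4 _ (dimH w w0) (zH w wz)).
have /orP[/eqP es|/eqP es] : (s == 1) || (s == -1) by rewrite -sqrf_eq1 s1.
  exists (k *: zeta); split; [by exists k|left].
  apply/seteqP; split=> y.
    by move=> /KL; rewrite es scale1r => Ly; exists (y - k *: zeta); rewrite ?subrK.
  by case=> z Lz <-; apply/KL; rewrite es scale1r addrK.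
exists (- k *: zeta); split; [by exists (- k)|right].
apply/seteqP; split=> y.
  move=> /KL; rewrite es scaleN1r => Ly; exists (y + k *: zeta).
    by exists (- y - k *: zeta) => //; rewrite opprD !opprK.
  by rewrite scaleNr addrK.
case=> _ [z Lz <-] <-; apply/KL; rewrite es scaleN1r opprD opprK scaleNr opprK.
by rewrite addrK.
Qed.
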